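(* Let $A$ be an expanding $d\times d$ integer matrix all of whose eigenvalues have equal moduli, let $\mathcal{D}_1,\mathcal{D}_2\subset\mathbb{Z}^d$ be finite nonempty digit sets, and let $K=A^{-1}(K+\mathcal{D}_1)$ and $K'=A^{-1}(K'+\mathcal{D}_2)$ be the corresponding integral self-affine sets. Suppose that both iterated function systems $\{x\mapsto A^{-1}(x+e)\}_{e\in\mathcal{D}_1}$ and $\{x\mapsto A^{-1}(x+e)\}_{e\in\mathcal{D}_2}$ satisfy the open set condition and that $K$ and $K'$ are totally disconnected. Then $K\simeq_n K'$ if and only if $\#\mathcal{D}_1=\#\mathcal{D}_2$.
   Context: A matrix is expanding if all its eigenvalues have modulus strictly greater than $1$. For a finite digit set $\mathcal{D}\subset\mathbb{Z}^d$, the integral self-affine set of $(A,\mathcal{D})$ is the unique nonempty compact $K\subset\mathbb{R}^d$ with $K=A^{-1}(K+\mathcal{D})$. Open set condition for $\{S_i\}_{i=1}^N$: there is a bounded nonempty open set $O$ with $\bigcup_{i=1}^N S_i(O)\subset O$ and $S_i(O)\cap S_j(O)=\emptyset$ for $i\ne j$. $E\simeq_n F$ (nearly Lipschitz equivalence) means: for every $0<\eta<1$ there exist a bijection $\sigma:E\to F$ and a constant $C>0$ such that $C^{-1}\|x-y\|^{1/\eta}\le\|\sigma(x)-\sigma(y)\|\le C\|x-y\|^{\eta}$ for all $x,y\in E$, where $\|\cdot\|$ is the Euclidean norm. *)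

(* Defs.v *)
From HB Require Import structures.
From mathcomp Require Import all_boot all_order all_algebra finmap.
From mathcomp Require Import complex.
From mathcomp Require Import all_classical all_reals all_analysis.

Set Implicit Arguments.
Unset Strict Implicit.
Unset Printing Implicit Defensive.

Import Order.TTheory GRing.Theory Num.Theory.
Import numFieldNormedType.Exports.

Local Open Scope classical_set_scope.
Local Open Scope ring_scope.

(* Complex eigenvalues; mathcomp's [eigenvalue] uses left (row) eigenvectors,
   which gives the same eigenvalues as column eigenvectors. *)
Definition complex_eigenvalue (R : realType) (d : nat) (A : 'M[int]_d) :
    pred (complex R) :=
  eigenvalue (map_mx (intmul 1) A : 'M[complex R]_d).

Definition expanding (R : realType) (d : nat) (A : 'M[int]_d) : Prop :=
  forall z : complex R, complex_eigenvalue A z -> 1 < `|z|.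

Definition equal_moduli (R : realType) (d : nat) (A : 'M[int]_d) : Prop :=
  forall z w : complex R,
    complex_eigenvalue A z -> complex_eigenvalue A w -> `|z| = `|w|.

Definition ifs_map (R : realType) (d : nat) (A : 'M[int]_d) (e : 'cV[int]_d)
    (x : 'cV[R]_d) : 'cV[R]_d :=
  invmx (map_mx (intmul 1) A) *m (x + map_mx (intmul 1) e).

(* For expanding [A] and nonempty [D] there is exactly one such [K]. *)
Definition self_affine_set (R : realType) (d : nat) (A : 'M[int]_d)
    (D : {fset 'cV[int]_d}) (K : set 'cV[R]_d) : Prop :=
  [/\ K !=set0, compact K & K = \bigcup_(e in [set` D]) (ifs_map A e @` K)].

(* The topology on ['cV[R]_d] is that of the sup norm, i.e. the Euclidean one;
   boundedness does not depend on the choice between these norms either. *)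
Definition open_set_condition (R : realType) (d : nat) (I : choiceType)
    (D : {fset I}) (S : I -> 'cV[R]_d -> 'cV[R]_d) : Prop :=
  exists O : set 'cV[R]_d,
    [/\ bounded_set O, O !=set0, open O,
        \bigcup_(i in [set` D]) (S i @` O) `<=` O
      & forall i j, i \in D -> j \in D -> i != j ->
          (S i @` O) `&` (S j @` O) = set0].

Definition euclidean_norm (R : realType) (d : nat) (x : 'cV[R]_d) : R :=
  Num.sqrt (\sum_(i < d) x i ord0 ^+ 2).

Definition nearly_lipschitz_equiv (R : realType) (d : nat)
    (E F : set 'cV[R]_d) : Prop :=
  forall eta : R, 0 < eta < 1 ->
    exists sigma : 'cV[R]_d -> 'cV[R]_d, exists C : R,
      [/\ set_bij E F sigma, 0 < C
        & forall x y, E x -> E y ->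
            C^-1 * euclidean_norm (x - y) `^ (1 / eta)
              <= euclidean_norm (sigma x - sigma y)
              <= C * euclidean_norm (x - y) `^ eta].

(* Main.v *)
Require Import Defs.
From mathcomp Require Import all_boot all_order all_algebra finmap.
From mathcomp Require Import complex ring lra zify.
From mathcomp Require Import all_classical all_reals all_analysis.

(** Write r for the common modulus of the eigenvalues of A, M for A seen as a
    real matrix, and N for the number of digits.  For every exponent slack the
    powers M^k grow at most like r^((1+delta)k) and the powers of the inverse
    decay at least like r^(-(1-delta)k) (equal_moduli_growth), so up to such a
    slack A acts as a similarity of ratio r.  The open set condition enters
    only through one consequence: the N^k integer vectors
    e_1 + A e_2 + ... + A^(k-1) e_k are pairwise distinct
    (osc_word_val_inj), hence 1-separated.

    Equivalent sets have equally many digits because a self-affine set with N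
    digits has dimension log N / log r.  The N^k pieces of level k cover it
    with diameters about r^(-k), while the distinct integer vectors give N^k
    points at mutual distance about r^(-k); a map whose Hoelder exponent is
    close to 1 cannot pack N'^m such points into N^n pieces when N < N' and
    m/n is slightly below 1 (holder_card_le).

    Conversely, let both sets have N digits.  Join two pieces of level k when
    they meet.  Total disconnectedness forces the connected components of
    these graphs to have a bounded number of pieces, uniformly in k
    (connected_words_close): after rescaling by A^k a long component would be
    a fine chain of points of large diameter inside a fixed finite union of
    integer translates of K, and that union, being compact and totally
    disconnected, carries no such chain (chain_bounded_tdisc,
    chain_boundedU).  The unions of pieces over the components are the cells
    of level k; they have diameter about r^(-k), are about r^(-k) apart, and
    each contains N^j cells of level k+j up to a bounded factor.

    Cells do not have equally many subcells, but near Lipschitz equivalence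
    leaves room to correct this.  A set of subcells of a cell can be split into
    exactly N^L parts, each lying between two consecutive levels, whose level
    differs from the current one by L up to a constant t that does not depend
    on L (node_split).  Iterating codes K bijectively by sequences over an
    alphabet of N^L letters, two points whose codes first differ
    after n letters being at distance about r^(-(L +- t) n)
    (self_affine_coded).  Both sets get codes over the same alphabet; matching
    equal codes is a bijection whose Hoelder exponents tend to 1 as delta tends
    to 0 and L grows (coded_nearly_lipschitz). *)

Set Implicit Arguments.
Unset Strict Implicit.
Unset Printing Implicit Defensive.

Import Order.TTheory GRing.Theory Num.Theory.
Import numFieldNormedType.Exports.

Local Open Scope classical_set_scope.
Local Open Scope ring_scope.

(** * Fine chains in compact totally disconnected sets *)

(** The form in which compactness is used throughout: a property that holds
    near each point at some scale, and persists at smaller scales, holds at one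
    scale everywhere. *)
Lemma compact_uniform (R : realType) (V : normedModType R) (K : set V)
    (P : R -> V -> Prop) :
  compact K -> (forall e e' x, 0 < e' <= e -> P e x -> P e' x) ->
  (forall x, K x -> exists2 e, 0 < e & forall y, `|x - y| < e -> P e y) ->
  exists2 e, 0 < e & forall x, K x -> P e x.
Proof.
move=> /compact_near_coveringP cK Pmono Ploc.
have H : \forall e \near 0^'+, K `<=` P e.
  apply: cK => x Kx; have [e e0 Pe] := Ploc x Kx.
  exists (ball x e, [set e' | 0 < e' <= e]); first split=> /=.
  - exact: nbhsx_ballx.
  - near=> e'; apply/andP; split=> //=.
    by near: e'; exact: nbhs_right_le.
  - by move=> [y e'] /= [+ e'e]; rewrite -ball_normE /= => /Pe; exact: Pmono e'e.
have [e [e0 He]] : exists e, 0 < e /\ K `<=` P e.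
  near (0:R)^'+ => e; exists e; split=> //; near: e; exact: H.
by exists e.
Unshelve. all: by end_near. Qed.

Lemma compact_closed_gap (R : realType) (V : normedModType R) (A B : set V) :
  compact A -> closed B -> A `&` B = set0 ->
  exists2 e, 0 < e & forall a b, A a -> B b -> e <= `|a - b|.
Proof.
move=> cA cB AB0.
have [e e0 He] : exists2 e, 0 < e & forall a, A a ->
    forall b, B b -> e <= `|a - b|.
  apply: compact_uniform => // [e e' x /andP[_ le_e] He b Bb|a Aa].
    exact: le_trans le_e (He b Bb).
  have /nbhs_ballP[e /= e0 He] : nbhs a (~` B).
    apply: open_nbhs_nbhs; split; first exact: closed_openC.
    by move=> Ba; have : (A `&` B) a by []; rewrite AB0.
  exists (e / 2); first by rewrite divr_gt0.
  move=> a' aa' b Bb; rewrite leNgt; apply/negP => a'b.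
  suff : ball a e b by move/He.
  rewrite -ball_normE /=.
  rewrite -(subrK a' a) -addrA (le_lt_trans (ler_normD _ _))//.
  by rewrite (splitr e) ltrD.
by exists e => // a b Aa; exact: He.
Qed.

Inductive chain (R : realType) (V : normedModType R) (T : set V) (e : R) (x : V)
  : V -> Prop :=
| chain_refl : T x -> chain T e x x
| chain_step y z : chain T e x y -> T z -> `|y - z| < e -> chain T e x z.

Section Chains.
Variables (R : realType) (V : normedModType R).
Implicit Types (T S K : set V) (e c : R) (x y z : V).

Lemma chain_end T e x y : chain T e x y -> T y.
Proof. by case. Qed.

Lemma chain_start T e x y : chain T e x y -> T x.
Proof. by elim. Qed.

Lemma chain_mono T S e e' x y : T `<=` S -> e <= e' -> chain T e x y -> chain S e' x y.
Proof.
move=> TS ee'; elim=> [/TS Sx|y' z _ IH /TS Sz yz]; first exact: chain_refl.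
by apply: chain_step IH Sz _; exact: lt_le_trans ee'.
Qed.

Lemma chain_trans T e x y z : chain T e x y -> chain T e y z -> chain T e x z.
Proof. by move=> xy; elim=> // u v _ IH Tv uv; exact: chain_step IH Tv uv. Qed.

Lemma chain_cons T e x y z : T x -> `|x - y| < e -> chain T e y z -> chain T e x z.
Proof.
move=> Tx xy yz; apply: (chain_trans _ yz).
by apply: (chain_step (chain_refl e Tx)) => //; exact: chain_start yz.
Qed.

Lemma chain_exit T e x y (N : set V) : chain T e x y -> N x -> ~ N y ->
  exists u v, [/\ chain T e x v, N u, ~ N v & `|u - v| < e].
Proof.
move=> + Nx; elim=> [//|u v xu IH Tv uv nv].
have [Nu|nNu] := pselect (N u); last exact: IH.
by exists u, v; split=> //; exact: chain_step uv.
Qed.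

(** The points that no separation of [K] at a positive scale cuts off from [x];
    for compact [K] this is the connected component of [x]. *)
Definition quasi K x : set V := [set y | K y /\ forall e, 0 < e -> chain K e x y].

Lemma quasi_local K x y : K y -> ~ quasi K x y ->
  exists2 e, 0 < e & forall y', `|y - y'| < e -> ~ chain K e x y'.
Proof.
move=> Ky nQ; have [e e0 nc] : exists2 e, 0 < e & ~ chain K e x y.
  apply: contrapT => H; apply: nQ; split=> // e e0; apply: contrapT => nc.
  by apply: H; exists e.
by exists e => // y' yy' c; apply: nc; apply: chain_step c Ky _; rewrite distrC.
Qed.

Lemma quasi_compact K x : compact K -> compact (quasi K x).
Proof.
move=> cK; apply: (@subclosed_compact _ _ K) => //; last by move=> y [].
have clK : closed K by apply: compact_closed => //; exact: norm_hausdorff.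
move=> y yQ; have Ky : K y.
  by apply: clK => U /yQ [z [[Kz _] Uz]]; exists z.
apply: contrapT => /(quasi_local Ky)[e e0 He].
have [z [[_ Qz]]] := yQ _ (nbhsx_ballx y e e0).
by rewrite -ball_normE /= => /He; apply; exact: Qz.
Qed.

(** If the set of points chained to [x] at every scale split into two closed
    parts, chains from [x] into the other part would have to leave a
    neighbourhood of the first part and land, at every fine scale, in the gap
    between the two; a limit of these exit points would be chained to [x] at
    every scale while lying in neither part. *)
Lemma quasi_connected K x : compact K -> K x -> connected (quasi K x).
Proof.
move=> cK Kx B [b Bb] [C oC BC] [D cD BD].
set Q := quasi K x; apply: contrapT => BQ.
have Qx : Q x by split=> // e e0; exact: chain_refl.
have cQ := quasi_compact cK : compact (quasi K x).
have clQ : closed Q by apply: compact_closed => //; exact: norm_hausdorff.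
have BsQ : B `<=` Q by rewrite BC; exact: subIsetl.
have [q Qq nBq] : exists2 q, Q q & ~ B q.
  apply: contrapT => H; apply: BQ; apply/seteqP; split=> // q Qq.
  by apply: contrapT => nBq; apply: H; exists q.
have clB : closed B by rewrite BD; exact: closedI.
have cB : compact B by exact: subclosed_compact BsQ.
have clB' : closed (Q `\` B).
  rewrite (_ : _ `\` _ = Q `&` ~` C); first by apply: closedI => //; exact: open_closedC.
  apply/seteqP; split=> z [Qz nz]; split=> // nz'; apply: nz; first by rewrite BC.
  by move: nz'; rewrite BC => -[].
have cB' : compact (Q `\` B) by apply: subclosed_compact cQ _ => // z [].
(* B need not contain x; B1 is whichever of B and its complement in Q does. *)
have [B1 [B2 [cB1 clB2 [B1x [y B2y]] QB B12]]] : exists B1 B2, [/\ compact B1, closed B2,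
    B1 x /\ B2 !=set0, Q `<=` B1 `|` B2 & (B1 `&` B2 = set0) /\ B2 `<=` Q].
  have [Bx|nBx] := pselect (B x).
    exists B, (Q `\` B); split=> //; first by split=> //; exists q.
      by move=> z Qz; have [|] := pselect (B z); [left|right].
    by split; [rewrite setDE setICA setICr setI0|exact: subDsetl].
  exists (Q `\` B), B; split=> //; first by split=> //; exists b.
    by move=> z Qz; have [|] := pselect (B z); [right|left].
  by split=> //; rewrite setDE -setIA [X in _ `&` X]setIC setICr setI0.
case: B12 => B12 B2Q.
have [g g0 gap] := compact_closed_gap cB1 clB2 B12.
have d0 : 0 < g / 3%:R by rewrite divr_gt0.
pose N1 := [set u | exists2 a, B1 a & `|a - u| < g / 3%:R].
pose N2 := [set u | exists2 a, B2 a & `|a - u| < g / 3%:R].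
have [e e0 He] : exists2 e, 0 < e & forall u, K u ->
    ~ (chain K e x u /\ ~ (N1 `|` N2) u) /\ e <= g / 3%:R.
  apply: compact_uniform => // [e e' u /andP[e'0 le_e] [H leg]|u Ku].
    split; last exact: le_trans leg.
    by move=> [c nN]; apply: H; split=> //; apply: chain_mono c.
  have [Qu|nQu] := pselect (Q u).
    exists (g / 3%:R) => // v uv; split=> // -[_]; apply.
    by have [B1u|B2u] := QB _ Qu; [left|right]; exists u.
  have [e e0 H] := quasi_local Ku nQu.
  exists (Num.min e (g / 3%:R)); first by rewrite lt_min e0.
  move=> v uv; split; last by rewrite ge_min lexx orbT.
  move=> [c _]; apply: (H v); first by apply: lt_le_trans uv _; rewrite ge_min lexx.
  by apply: chain_mono c => //; rewrite ge_min lexx.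
have nN1y : ~ N1 y.
  move=> [a B1a ay]; have := gap _ _ B1a B2y; rewrite leNgt => /negP; apply.
  by apply: lt_trans ay _; lra.
have [] := @chain_exit K e x y N1.
- by have [_] := B2Q _ B2y; exact.
- by exists x => //; rewrite subrr normr0.
- exact: nN1y.
move=> u [v [xv [a B1a au] nN1v uv]].
have [H leg] := He v (chain_end xv); apply: H; split=> // -[//|[b' B2b bv]].
have := gap _ _ B1a B2b; rewrite leNgt => /negP; apply.
have -> : a - b' = (a - u) + (u - v) - (b' - v) by rewrite opprB !subrKA.
by apply: (le_lt_trans (ler_normB _ _)); have := ler_normD (a - u) (u - v); lra.
Qed.

(** A metric substitute for total disconnectedness which, unlike the
    topological notion, passes to finite unions by an elementary argument. *)
Definition chain_bounded T := forall c, 0 < c ->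
  exists2 e, 0 < e & forall x y, chain T e x y -> `|x - y| < c.

(** Components are points, so each point has a scale at which its chains stay
    short; compactness makes this scale uniform. *)
Lemma chain_bounded_tdisc K :
  compact K -> totally_disconnected K -> chain_bounded K.
Proof.
move=> cK tdK c c0.
have quasi1 x y : K x -> quasi K x y -> y = x.
  move=> Kx Qy; have : connected_component K x y.
    apply: (@connected_component_max _ K (quasi K x)) => //.
    - by split=> // e e0; exact: chain_refl.
    - by move=> z [].
    - exact: quasi_connected.
  by rewrite tdK.
have c2 : 0 < c / 2 by rewrite divr_gt0.
have local x : K x -> exists2 e, 0 < e & forall y, K y -> chain K e x y -> `|x - y| < c / 2.
  move=> Kx; apply: compact_uniform => // [e e' y /andP[_ le_e] H ch|y Ky].
    by apply: H; apply: chain_mono ch.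
  have [xy|xy] := ltP `|x - y| (c / 2).
    exists (c / 2 - `|x - y|); first by rewrite subr_gt0.
    move=> y' yy' _; rewrite -(subrK y x) -addrA (le_lt_trans (ler_normD _ _))//.
    by rewrite -ltrBrDl.
  have [|e e0 H] := @quasi_local K x y Ky.
    by move=> /(quasi1 _ _ Kx) yx; move: xy; rewrite yx subrr normr0 leNgt c2.
  by exists e => // y' yy' /(H _ yy').
have [e e0 He] : exists2 e, 0 < e & forall x, K x ->
    forall y, chain K e x y -> `|x - y| < c.
  apply: compact_uniform => // [e e' x /andP[_ le_e] H y ch|x Kx].
    by apply: H; apply: chain_mono ch.
  have [e e0 He] := local x Kx; exists e => // y xy z yz.
  have xz : chain K e x z by exact: chain_cons yz.
  have := He _ (chain_end xz) xz.
  have Ky := chain_start yz.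
  have := He _ Ky (chain_step (chain_refl e Kx) Ky xy).
  have -> : y - z = (x - z) - (x - y) by rewrite opprB [RHS]addrC subrKA.
  by move=> h1 h2; rewrite (le_lt_trans (ler_normB _ _))// (splitr c) ltrD.
by exists e => // x y ch; apply: (He x _ _ ch); exact: chain_start ch.
Qed.

(** Fix the scale [e1] for [T], then choose the scale for [S] so fine that an
    excursion of the chain through [S] moves less than [e1]: skipping all
    excursions leaves a chain of [T] at scale [e1]. *)
Lemma chain_boundedU T S : chain_bounded T -> chain_bounded S -> chain_bounded (T `|` S).
Proof.
move=> bT bS c c0.
have c4 : 0 < c / 4%:R by rewrite divr_gt0.
have [e1 e10 He1] := bT _ c4.
pose m := Num.min (e1 / 4%:R) (c / 8%:R).
have m0 : 0 < m by rewrite lt_min !divr_gt0.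
have [e2 e20 He2] := bS _ m0.
pose e := Num.min e2 m.
have e0 : 0 < e by rewrite lt_min e20.
have ee2 : e <= e2 by rewrite ge_min lexx.
have em : e <= m by rewrite ge_min lexx orbT.
have me1 : m <= e1 / 4%:R by rewrite ge_min lexx.
have mc : m <= c / 8%:R by rewrite ge_min lexx orbT.
exists e => // x y xy.
(* Invariant along the chain: a is the first point in T, b the last one, and
   the current point is b or is reached from b by an excursion through S. *)
have key z : chain (T `|` S) e x z ->
    (exists a, [/\ T a, `|x - a| < m + e & exists b, chain T e1 a b /\
      (b = z \/ exists s, chain S e s z /\ `|b - s| < e)]) \/ chain S e x z.
  elim=> [[Tx|Sx]|u v _ IH Tv uv].
  - left; exists x; split=> //; first by rewrite subrr normr0 addr_gt0.
    by exists x; split; [exact: chain_refl|left].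
  - by right; exact: chain_refl.
  - case: IH => [[a [Ta xa [b [ab ub]]]]|xu].
      case: Tv => [Tv|Sv].
        left; exists a; split=> //; exists v; split; last by left.
        apply: chain_step ab Tv _; case: ub => [->|[s [su bs]]].
          by apply: lt_le_trans uv _; lra.
        have := He2 _ _ (chain_mono (@subset_refl _ S) ee2 su).
        have -> : b - v = (b - s) + (s - u) + (u - v) by rewrite !subrKA.
        have := ler_normD ((b - s) + (s - u)) (u - v).
        by have := ler_normD (b - s) (s - u); lra.
      left; exists a; split=> //; exists b; split=> //; right.
      case: ub => [bu|[s [su bs]]].
        by exists v; split; [exact: chain_refl|rewrite bu].
      by exists s; split=> //; exact: chain_step uv.
    case: Tv => [Tv|Sv]; last by right; exact: chain_step uv.
    left; exists v; split=> //.
      have := He2 _ _ (chain_mono (@subset_refl _ S) ee2 xu).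
      have -> : x - v = (x - u) + (u - v) by rewrite subrKA.
      by have := ler_normD (x - u) (u - v); lra.
    by exists v; split; [exact: chain_refl|left].
case: (key _ xy) => [[a [Ta xa [b [ab by_]]]]|xSy]; last first.
  by have := He2 _ _ (chain_mono (@subset_refl _ S) ee2 xSy); lra.
have h1 := He1 _ _ ab.
have h2 : `|b - y| < m + e.
  case: by_ => [->|[s [sy bs]]]; first by rewrite subrr normr0 addr_gt0.
  have := He2 _ _ (chain_mono (@subset_refl _ S) ee2 sy).
  have -> : b - y = (b - s) + (s - y) by rewrite subrKA.
  by have := ler_normD (b - s) (s - y); lra.
have -> : x - y = (x - a) + (a - b) + (b - y) by rewrite !subrKA.
have := ler_normD ((x - a) + (a - b)) (b - y).
by have := ler_normD (x - a) (a - b); lra.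
Qed.

Lemma chain_bounded_translate T v : chain_bounded T -> chain_bounded [set x | T (x - v)].
Proof.
move=> bT c c0; have [e e0 He] := bT c c0; exists e => // x y xy.
have -> : x - y = (x - v) - (y - v) by rewrite opprB subrKA.
apply: He; elim: xy => [Tx|u w _ IH Tw uw]; first exact: chain_refl.
by apply: chain_step IH Tw _; rewrite opprB subrKA.
Qed.

Lemma chain_bounded_translates T (I : eqType) (s : seq I) (f : I -> V) :
  chain_bounded T -> chain_bounded [set x | exists2 i, i \in s & T (x - f i)].
Proof.
move=> bT; elim: s => [c c0|i s IH].
  by exists 1 => // x y /chain_start [].
have := chain_boundedU (chain_bounded_translate (f i) bT) IH.
congr chain_bounded; apply/seteqP; split=> x /=.
  move=> [Tx|[j js Tx]]; first by exists i => //; rewrite inE eqxx.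
  by exists j => //; rewrite inE js orbT.
move=> [j]; rewrite inE => /orP[/eqP-> |js] Tx; first by left.
by right; exists j.
Qed.

End Chains.

(** * Growth of matrix powers *)

(** Induction on the annihilating product: the sequence [X ^+ k * Y] solves the
    recursion u(k+1) = z u(k) + v(k), where v is the sequence of
    [(X - z%:M) * Y], which has one factor less to kill, and |z| < rho keeps the
    bound geometric. *)
Lemma annihilated_growth (F : numFieldType) n (X : 'M[F]_n.+1) (rho : F) (s : seq F) :
  0 < rho -> {in s, forall z, `|z| < rho} ->
  forall Y : 'M[F]_n.+1, \prod_(z <- s) (X - z%:M) * Y = 0 ->
  exists2 C, 0 <= C & forall k i j, `|(X ^+ k * Y) i j| <= C * rho ^+ k.
Proof.
move=> rho0; elim: s => [|z s IH] slt Y.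
  rewrite big_nil mul1r => ->; exists 0 => // k i j.
  by rewrite mulr0 mxE normr0 mul0r.
rewrite big_cons -mulrA.
have comm : (X - z%:M) * \prod_(z <- s) (X - z%:M) =
    \prod_(z <- s) (X - z%:M) * (X - z%:M).
  have scalC (W : 'M[F]_n.+1) t : GRing.comm W t%:M by rewrite /GRing.comm -[RHS]scalar_mxC.
  by apply: commr_prod => w _; apply: commrB => //; apply/commr_sym/commrB.
rewrite mulrA comm -mulrA => /IH[w ws|C C0 HC].
  by apply: slt; rewrite inE ws orbT.
have zrho : 0 < rho - `|z| by rewrite subr_gt0; apply: slt; rewrite inE eqxx.
pose C' := C / (rho - `|z|) + \sum_i \sum_j `|Y i j|.
have S0 : 0 <= \sum_i \sum_j `|Y i j|.
  by apply: sumr_ge0 => i _; apply: sumr_ge0.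
have C'0 : 0 <= C' by rewrite addr_ge0// divr_ge0// ltW.
exists C' => // k i j; elim: k => [|k IHk].
  rewrite expr0 mul1r expr0 mulr1 /C'.
  have: `|Y i j| <= \sum_i \sum_j `|Y i j|.
    rewrite (bigD1 i)//= (bigD1 j)//= -addrA lerDl addr_ge0//; first by apply: sumr_ge0.
    by apply: sumr_ge0 => ? _; apply: sumr_ge0.
  by move=> /le_trans; apply; rewrite lerDr divr_ge0// ltW.
have -> : X ^+ k.+1 * Y = z *: (X ^+ k * Y) + X ^+ k * ((X - z%:M) * Y).
  rewrite exprSr -mulrA mulrBl mulrBr -[z%:M * Y]/(z%:M *m Y) mul_scalar_mx.
  by rewrite -scalerAr addrC subrK.
rewrite mxE (le_trans (ler_normD _ _))// mxE normrM.
apply: le_trans (_ : `|z| * (C' * rho ^+ k) + C * rho ^+ k <= _).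
  by apply: lerD => //; apply: ler_wpM2l.
rewrite exprS !mulrA -mulrDl [C' * rho]mulrC ler_wpM2r ?exprn_ge0 ?(ltW rho0)//.
rewrite -lerBrDl -mulrBl /C' mulrDr [X in _ <= X + _]mulrC divfK ?gt_eqF//.
by rewrite lerDl mulr_ge0// ltW.
Qed.

(** Over an algebraically closed field the characteristic polynomial splits and
    annihilates the matrix by Cayley-Hamilton. *)
Lemma eigenvalue_growth (F : numClosedFieldType) n (X : 'M[F]_n.+1) (rho : F) :
  0 < rho -> (forall z, eigenvalue X z -> `|z| < rho) ->
  exists2 C, 0 <= C & forall k i j, `|(X ^+ k) i j| <= C * rho ^+ k.
Proof.
move=> rho0 Hev; have [s chs] := closed_field_poly_normal (char_poly X).
have chs' : char_poly X = \prod_(z <- s) ('X - z%:P).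
  by rewrite chs (monicP (char_poly_monic X)) scale1r.
have slt : {in s, forall z, `|z| < rho}.
  by move=> z zs; apply: Hev; rewrite eigenvalue_root_char chs' root_prod_XsubC.
have /(annihilated_growth rho0 slt)[C C0 HC] : \prod_(z <- s) (X - z%:M) * 1 = 0.
  rewrite mulr1 -(Cayley_Hamilton X) chs' rmorph_prod; apply: eq_bigr => z _.
  by rewrite rmorphB /= horner_mx_X horner_mx_C.
by exists C => // k i j; have := HC k i j; rewrite mulr1.
Qed.

Lemma mulmx_norm_le (R : realType) m n (X : 'M[R]_(m, n)) (x : 'cV[R]_n) C :
  0 <= C -> (forall i j, `|X i j| <= C) -> `|X *m x| <= n%:R * C * `|x|.
Proof.
move=> C0 HX; rewrite [leLHS]/Num.Def.normr /= mx_normrE bigmax_le//.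
  by rewrite !mulr_ge0.
move=> [i j] _ /=; rewrite mxE (le_trans (ler_norm_sum _ _ _))//.
rewrite -mulrA -[n in n%:R]card_ord -sum1_card natr_sum mulr_suml ler_sum// => k _.
rewrite mul1r normrM ler_pM//.
by rewrite [leRHS]/Num.Def.normr /= mx_normrE; apply/bigmax_geP; right; exists (k, j).
Qed.

Lemma real_eigenvalue_growth (R : realType) n (M : 'M[R]_n.+1) (rho : R) :
  0 < rho ->
  (forall z : R[i], eigenvalue (map_mx (real_complex R) M) z -> `|z| < rho%:C%C) ->
  exists2 C, 0 < C & forall k (x : 'cV[R]_n.+1), `|M ^+ k *m x| <= C * rho ^+ k * `|x|.
Proof.
move=> rho0 Hev; have rhoC : 0 < rho%:C%C by rewrite ltcR.
have [C C0 HC] := eigenvalue_growth rhoC Hev.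
have Cr : C = (complex.Re C)%:C%C.
  by move: C0; case: (C) => a b; rewrite lecE /= => /andP[/eqP -> _].
move: C0 HC; rewrite Cr lecR; set c := complex.Re C => c0 HC.
exists (n.+1%:R * c + 1); first by rewrite ltr_wpDl// mulr_ge0.
move=> k x; apply: (@le_trans _ _ (n.+1%:R * (c * rho ^+ k) * `|x|)).
  apply: mulmx_norm_le; first by rewrite mulr_ge0// exprn_ge0// ltW.
  move=> i j; have := HC k i j; rewrite -rmorphXn /= mxE -rmorphXn /= -rmorphM /=.
  by rewrite normc_def /= expr0n addr0 sqrtr_sqr lecR.
by rewrite mulrA !ler_wpM2r ?exprn_ge0 ?(ltW rho0)//; rewrite lerDl ler01.
Qed.

(** * Trees of cells and codings *)

(** Between the coarse partition of [S] by the fibres of [g] and the partition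
    into points there is a partition with any prescribed intermediate number of
    classes: starting from the coarse one, split off one point at a time. *)
Lemma intermediate_partition (X Y : finType) (S : {set X}) (g : X -> Y) B :
  (#|[set g x | x in S]%SET| <= B <= #|S|)%N ->
  exists f : X -> nat, [/\ forall x, x \in S -> (f x < B)%N,
    forall b, (b < B)%N -> exists2 x, x \in S & f x = b
    & {in S &, forall x y, f x = f y -> g x = g y}].
Proof.
move=> /andP[]; set G := [set g x | x in S]%SET => GB.
have [k ->] : exists k, B = (#|G| + k)%N by exists (B - #|G|)%N; rewrite subnKC.
elim: k => [|k IH] kS; rewrite ?addn0 ?addnS in kS *.
  have gG x : x \in S -> g x \in G by move=> xS; apply: imset_f.
  exists (fun x => index (g x) (enum G)); split.
  - by move=> x /gG; rewrite cardE index_mem mem_enum.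
  - move=> b; rewrite cardE => blt.
    have [y0 _] : {y0 | y0 \in enum G} by case: (enum G) blt => // y ? _; exists y; rewrite mem_head.
    have := mem_nth y0 blt; rewrite mem_enum => /imsetP[x xS nx].
    by exists x => //; rewrite -nx index_uniq// enum_uniq.
  - move=> x y xS yS eqi.
    by rewrite -(nth_index (g x) (_ : g x \in enum G)) ?mem_enum ?gG// eqi nth_index ?mem_enum ?gG.
have [f [flt fonto fg]] := IH (ltnW kS).
have [x1 [x2 [x1S x2S x12 f12]]] : exists x1 x2, [/\ x1 \in S, x2 \in S, x1 != x2 & f x1 = f x2].
  apply: contrapT => H; have : (#|S| <= #|G| + k)%N; last by rewrite leqNgt kS.
  rewrite cardE -(size_map f) -(size_iota 0 (#|G| + k)); apply: uniq_leq_size.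
    rewrite map_inj_in_uniq ?enum_uniq// => x y; rewrite !mem_enum => xS yS fxy.
    by apply/eqP/negPn/negP => xy; apply: H; exists x, y.
  by move=> _ /mapP[x + ->]; rewrite mem_enum mem_iota /= => /flt.
exists (fun x => if x == x1 then (#|G| + k)%N else f x); split.
- by move=> x xS; case: eqP => // _; rewrite ltnS ltnW// flt.
- move=> b; rewrite ltnS leq_eqVlt => /orP[/eqP ->|/fonto[x xS <-]]; first by exists x1; rewrite ?eqxx.
  have [->|xx1] := eqVneq x x1; first by exists x2 => //; rewrite eq_sym (negPf x12).
  by exists x => //; rewrite (negPf xx1).
- move=> x y xS yS; case: eqP => [->|_]; case: eqP => [->|_] //.
  + by move=> fy; have := flt _ yS; rewrite -fy ltnn.
  + by move=> fx; have := flt _ xS; rewrite fx ltnn.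
  + exact: fg.
Qed.

(** A bijection of [E] with the sequences over [B] letters, under which two
    points whose codes first differ at index [n] are at distance between
    [v ^+ n] and [u ^+ n], up to constants. *)
Definition coded (R : realType) (V : normedModType R) (E : set V) (B : nat) (u v : R) :=
  exists (code : V -> nat -> nat) (C c : R), [/\ 0 < C /\ 0 < c,
    forall x n, E x -> (code x n < B)%N,
    forall s, (forall n, s n < B)%N -> exists2 x, E x & forall n, code x n = s n,
    forall x y n, E x -> E y -> (forall i, (i < n)%N -> code x i = code y i) ->
      `|x - y| <= C * u ^+ n
  & forall x y n, E x -> E y -> (forall i, (i < n)%N -> code x i = code y i) ->
      code x n <> code y n -> c * v ^+ n <= `|x - y|].

Section CellTree.
Variables (R : realType) (V : normedModType R) (E : set V).
Variables (F : nat -> finType) (lab : forall k, V -> F k).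
Variables (par : forall k, F k.+1 -> F k) (N M : nat) (C c alpha beta : R).

Definition cell k x : set V := [set y | E y /\ lab k y = lab k x].

Definition labels k (Q : set V) : {set F k} :=
  [set l | `[< exists2 x, Q x & lab k x = l >]]%SET.

(** The nodes of the tree to be built: unions of cells of level k+1 inside one
    cell of level k.  Allowing such unions is what makes a prescribed number of
    children possible. *)
Definition is_node k (Q : set V) := [/\ Q !=set0, Q `<=` E,
  forall x y, Q x -> Q y -> lab k x = lab k y
  & forall x y, Q x -> E y -> lab k.+1 x = lab k.+1 y -> Q y].

Hypothesis E_compact : compact E.
Hypothesis E_neq0 : E !=set0.
Hypothesis N_ge2 : (1 < N)%N.
Hypothesis lab_par : forall k x, E x -> lab k x = par (lab k.+1 x).
Hypothesis lab0 : forall x y, E x -> E y -> lab 0 x = lab 0 y.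
Hypothesis labels_upper : forall j k x, E x -> (#|labels (j + k) (cell k x)| <= M * N ^ j)%N.
Hypothesis labels_lower : forall j k x, E x -> (N ^ j <= M * #|labels (j + k) (cell k x)|)%N.
Hypothesis C_gt0 : 0 < C.
Hypothesis c_gt0 : 0 < c.
Hypothesis alpha01 : 0 < alpha <= 1.
Hypothesis beta01 : 0 < beta <= 1.
Hypothesis lab_close : forall k x y, E x -> E y -> lab k x = lab k y -> `|x - y| <= C * alpha ^+ k.
Hypothesis lab_far : forall k x y, E x -> E y -> lab k x <> lab k y -> c * beta ^+ k <= `|x - y|.

Lemma labelsP k Q x : Q x -> lab k x \in labels k Q.
Proof. by move=> Qx; rewrite inE; apply/asboolP; exists x. Qed.

Lemma labelsE k Q l : l \in labels k Q -> exists2 x, Q x & lab k x = l.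
Proof. by rewrite inE => /asboolP. Qed.

Lemma labelsS k Q Q' : Q `<=` Q' -> (#|labels k Q| <= #|labels k Q'|)%N.
Proof.
by move=> QQ'; apply/subset_leq_card/fintype.subsetP => l /labelsE[x /QQ' Qx <-]; exact: labelsP.
Qed.

Lemma node_labels_upper j k Q : is_node k Q -> (#|labels (j + k) Q| <= M * N ^ j)%N.
Proof.
move=> [[x Qx] QE Qlab _]; apply: leq_trans (labels_upper j k (QE _ Qx)).
by apply: labelsS => y Qy; split; [exact: QE|exact: Qlab].
Qed.

Lemma node_labels_lower j k Q : is_node k Q -> (N ^ j <= M * #|labels (j.+1 + k) Q|)%N.
Proof.
move=> [[x Qx] QE _ Qsat]; apply: leq_trans (labels_lower j k.+1 (QE _ Qx)) _.
rewrite addnS leq_mul2l; apply/orP; right; apply: labelsS => y [Ey xy].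
exact: (Qsat x).
Qed.

(** Let j be the last relative level at which [Q] has at most N^L cells.  As
    there are more at level j+1, some partition of [Q] into exactly N^L classes
    lies between the cells of these two levels, and its classes are nodes of
    level k+j.  Since the number of cells of relative level j is N^j up to
    the factor [M], j differs from L by at most a constant. *)
Lemma node_split L k Q : is_node k Q ->
  exists j (f : V -> nat), [/\ (j <= L + M.+1)%N, (L <= j + M.+1)%N,
    forall b, (b < N ^ L)%N -> is_node (j + k) (Q `&` [set x | f x = b]),
    forall x, Q x -> (f x < N ^ L)%N
    & forall x y, Q x -> Q y -> lab (j + k).+1 x = lab (j + k).+1 y -> f x = f y].
Proof.
move=> nodeQ; have [[x0 Qx0] QE Qlab Qsat] := nodeQ.
have MN i : (M * N ^ i < N ^ (M + i))%N.
  by rewrite expnD ltn_pmul2r ?expn_gt0 ?(ltnW N_ge2)// ltn_expl.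
have exj : exists j, (N ^ L < #|labels (j.+1 + k) Q|)%N.
  exists (M + L)%N; have := leq_trans (MN L) (node_labels_lower (M + L) nodeQ).
  by rewrite ltn_mul2l => /andP[].
case: (ex_minnP exj) => j Bj jmin.
have jB : (#|labels (j + k) Q| <= N ^ L)%N.
  case: j Bj jmin => [|j] Bj jmin; last first.
    by rewrite leqNgt; apply/negP => /jmin; rewrite ltnn.
  apply: (@leq_trans 1%N); last by rewrite expn_gt0 (ltnW N_ge2).
  rewrite add0n -(cards1 (lab k x0)); apply/subset_leq_card/fintype.subsetP => l /labelsE[x Qx <-].
  by rewrite inE (Qlab x x0).
have imlab : [set par l | l in labels (j.+1 + k) Q]%SET = labels (j + k) Q.
  apply/setP => l; apply/imsetP/idP => [[l' /labelsE[x Qx <-] ->]|/labelsE[x Qx <-]].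
    by rewrite -lab_par ?labelsP//; exact: QE.
  by exists (lab (j + k).+1 x); [rewrite labelsP|rewrite -lab_par//; exact: QE].
have [|f [flt fonto fpar]] := @intermediate_partition _ _ (labels (j.+1 + k) Q) (@par _) (N ^ L)%N.
  by rewrite imlab jB ltnW.
exists j, (fun x => f (lab (j.+1 + k) x)); split.
- case: j jB {Bj jmin imlab f flt fonto fpar} => // j jB.
  have := leq_trans (node_labels_lower j nodeQ) (leq_mul (leqnn M) jB).
  move=> /leq_ltn_trans /(_ (MN L)); rewrite ltn_exp2l// => ?; lia.
- have := leq_trans Bj (node_labels_upper j.+1 nodeQ).
  move=> /ltn_trans /(_ (MN _)); rewrite ltn_exp2l// => ?; lia.
- move=> b /fonto[l lQ fl]; have [x Qx xl] := labelsE lQ; split.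
  + by exists x; split=> //=; rewrite xl.
  + by move=> y [/QE].
  + move=> y z [Qy fy] [Qz fz]; rewrite (lab_par _ (QE _ Qy)) (lab_par _ (QE _ Qz)).
    by apply: fpar; rewrite ?labelsP//; move: fy fz => /= -> ->.
  + move=> y z [Qy fy] Ez yz; have Qz : Q z; last by split=> //=; rewrite -yz.
    apply: (Qsat _ _ Qy Ez).
    elim: j yz {Bj jB jmin imlab f flt fonto fpar lQ fl xl fy l} => // j IH yz.
    apply: IH; rewrite (lab_par _ (QE _ Qy)) (lab_par _ Ez).
    exact: congr1 yz.
- by move=> x Qx; apply: flt; rewrite labelsP.
- by move=> x y Qx Qy xy; exact: (congr1 f xy).
Qed.

(** Iterate [node_split] and read off, for each point, the class in which it
    lies at each step.  A sequence of letters is the code of some point because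
    the nodes it describes are nested and, being far from their complements,
    closed in the compact set [E]. *)
Lemma cell_tree_coded : exists t, forall L, (t <= L)%N ->
  coded E (N ^ L) (alpha ^+ (L - t)) (beta ^+ (L + t)).
Proof.
exists M.+1 => L tL; set t := M.+1 in tL *.
(* The split is chosen for all pairs, nodes or not, to get a total function. *)
pose P (kQ : nat * set V) (jf : nat * (V -> nat)) := is_node kQ.1 kQ.2 ->
   let j := jf.1 in let f := jf.2 in let k := kQ.1 in let Q := kQ.2 in
   [/\ (j <= L + t)%N, (L <= j + t)%N,
    forall b, (b < N ^ L)%N -> is_node (j + k) (Q `&` [set x | f x = b]),
    forall x, Q x -> (f x < N ^ L)%N
    & forall x y, Q x -> Q y -> lab (j + k).+1 x = lab (j + k).+1 y -> f x = f y].
have /choice[sp spP] : forall kQ, exists jf, P kQ jf.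
  move=> [k Q]; rewrite /P /=.
  have [/(node_split L)[j [f H]]|nQ] := pselect (is_node k Q); first by exists (j, f).
  by exists (0%N, fun=> 0%N).
pose step (kQ : nat * set V) b := ((sp kQ).1 + kQ.1, kQ.2 `&` [set x | (sp kQ).2 x = b])%N.
(* node follows a given sequence of letters, pnode a given point. *)
pose node := fix node (s : nat -> nat) n := if n is n'.+1 then step (node s n') (s n') else (0%N, E).
pose pnode x := fix pnode n := if n is n'.+1 then step (pnode n') ((sp (pnode n')).2 x) else (0%N, E).
pose code x n := (sp (pnode x n)).2 x.
have pnodeE x n : pnode x n = node (code x) n by elim: n => //= n <-.
have node_ext s s' n : (forall i, (i < n)%N -> s i = s' i) -> node s n = node s' n.
  elim: n => //= n IH H; rewrite H// IH// => i ilt; apply: H; exact: ltnW.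
have nodeP s n : (forall i, (i < n)%N -> (s i < N ^ L)%N) -> [/\ is_node (node s n).1 (node s n).2,
    ((node s n).1 <= (L + t) * n)%N & ((L - t) * n <= (node s n).1)%N].
  elim: n => [|n IH] sB /=.
    by rewrite !muln0; split=> //; split.
  have [i ilt|nodeQ lo up] := IH; first by apply: sB; exact: ltnW.
  have [jL Lj nodes _ _] := spP _ nodeQ.
  split; first by apply: nodes; exact: sB.
    by rewrite mulnS leq_add.
  by rewrite mulnS leq_add// leq_subLR addnC.
have codeP x n : E x -> (code x n < N ^ L)%N /\ (node (code x) n).2 x.
  move=> Ex; have [n'] := ubnP n; elim: n' n => // n' IH n nn'.
  have cB i : (i < n)%N -> (code x i < N ^ L)%N.
    by move=> i_n; have [] := IH i (leq_trans i_n nn').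
  have [nodeQ _ _] := nodeP _ _ cB.
  have Qx : (node (code x) n).2 x.
    case: n nn' {cB nodeQ} => // n nn' /=; split; first by have [] := IH n nn'.
    by rewrite /= /code pnodeE.
  split=> //; rewrite /code pnodeE.
  by have [_ _ _ + _] := spP _ nodeQ; apply.
have nested s n m x : (n <= m)%N -> (node s m).2 x -> (node s n).2 x.
  by move=> /subnK <-; elim: (m - n)%N => // i IH /= [/IH].
exists code, C, (c * beta ^+ (L + t).+1).
have /andP[b0 b1] := beta01; have /andP[a0 a1] := alpha01.
split.
- by split=> //; rewrite mulr_gt0// exprn_gt0.
- by move=> x n Ex; have [] := codeP x n Ex.
- move=> s sB; apply: contrapT => noE.
  have nin x : E x -> exists n, ~ (node s n).2 x.
    move=> Ex; apply: contrapT => allin; apply: noE; exists x => // n.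
    have inall m : (node s m).2 x by apply: contrapT => nm; apply: allin; exists m.
    have [n'] := ubnP n; elim: n' n => // n' IH n nn'.
    have ext : node (code x) n = node s n.
      by apply: node_ext => i i_n; apply: IH; exact: (leq_trans i_n).
    by have [_ /= <-] := inall n.+1; rewrite /code pnodeE ext.
  (* Otherwise, by compactness, nodes of large depth would miss all of E. *)
  have [e e0 He] : exists2 e : R, 0 < e & forall x, E x ->
      forall n, e^-1 <= n%:R -> ~ (node s n).2 x.
    apply: (@compact_uniform R V E (fun e x => forall n, e^-1 <= n%:R -> ~ (node s n).2 x)) => // [e e' x /andP[e'0 le_e] H n en|x Ex].
      by apply: H; apply: le_trans en; rewrite lef_pV2// posrE (lt_le_trans e'0).
    have [n nx] := nin x Ex; have [[_ QE _ Qsat] _ _] := nodeP s n (fun i _ => sB i).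
    pose r := c * beta ^+ (node s n).1.+1.
    exists (Num.min r n.+1%:R^-1); first by rewrite lt_min invr_gt0 ltr0Sn mulr_gt0// exprn_gt0.
    move=> y; rewrite lt_min => /andP[xy _] m em Qy.
    have nm : (n <= m)%N.
      rewrite ltnW// -(ltr_nat R) (lt_le_trans _ em)//.
      rewrite (@lt_le_trans _ _ n.+1%:R) ?ltr_nat//.
      by rewrite -[leLHS]invrK lef_pV2 ?ge_min ?lexx ?orbT// posrE ?invr_gt0// lt_min ?invr_gt0 ltr0Sn mulr_gt0// exprn_gt0.
    have Qny := nested _ _ _ _ nm Qy.
    move: xy; apply/negP; rewrite -leNgt; apply: lab_far => //; first exact: QE.
    by move=> xyl; apply: nx; exact: Qsat Qny Ex (esym xyl).
  have [[[x Qx] QE _ _] _ _] := nodeP s (Num.truncn e^-1).+1 (fun i _ => sB i).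
  apply: (He x (QE _ Qx)) Qx; rewrite ltW//.
  exact: truncnS_gt.
- move=> x y n Ex Ey agree.
  have [cxB Qx] := codeP x n Ex; have [_ Qy] := codeP y n Ey.
  rewrite -(node_ext _ _ _ agree) in Qy.
  have [[_ _ Qlab _] _ lo] := nodeP (code x) n (fun i _ => (codeP x i Ex).1).
  apply: le_trans (lab_close Ex Ey (Qlab _ _ Qx Qy)) _.
  by rewrite ler_wpM2l ?(ltW C_gt0)// -exprM ler_wiXn2l// ltW.
- move=> x y n Ex Ey agree codexy.
  have [_ Qx] := codeP x n Ex; have [_ Qy] := codeP y n Ey.
  have nodexy := node_ext _ _ _ agree; rewrite -nodexy in Qy.
  have [nodeQ up _] := nodeP (code x) n (fun i _ => (codeP x i Ex).1).
  have [jL _ _ _ fsat] := spP _ nodeQ.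
  set k := (node (code x) n).1 in up fsat *; set j := (sp _).1 in jL fsat.
  apply: le_trans (_ : c * beta ^+ (j + k).+1 <= _); last first.
    apply: lab_far => // /(fsat _ _ Qx Qy) H; apply: codexy.
    by rewrite /code !pnodeE -nodexy.
  rewrite -mulrA ler_wpM2l ?(ltW c_gt0)// -exprM -exprD ler_wiXn2l ?(ltW b0)//.
  by rewrite addSn ltnS leq_add.
Qed.

End CellTree.

(** * From codings to near Lipschitz equivalence *)

Section Euclidean.
Variables (R : realType) (d : nat).
Implicit Types x : 'cV[R]_d.

Lemma norm_le_euclidean x : `|x| <= euclidean_norm x.
Proof.
rewrite [leLHS]/Num.Def.normr/= mx_normrE bigmax_le ?sqrtr_ge0// => -[i j] _ /=.
rewrite -sqrtr_sqr ler_wsqrtr// [j]ord1 (bigD1 i)//= lerDl.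
by apply: sumr_ge0 => k _; exact: sqr_ge0.
Qed.

Lemma euclidean_le_norm x : euclidean_norm x <= d%:R * `|x|.
Proof.
have dx0 : 0 <= d%:R * `|x| by rewrite mulr_ge0.
rewrite -[leRHS]ger0_norm// -sqrtr_sqr ler_wsqrtr//.
have le1 i : x i ord0 ^+ 2 <= `|x| ^+ 2.
  rewrite -(real_normK (num_real _)) ler_pXn2r ?nnegrE//.
  by rewrite [leRHS]/Num.Def.normr/= mx_normrE; apply/bigmax_geP; right; exists (i, ord0).
apply: (@le_trans _ _ (d%:R * `|x| ^+ 2)).
  rewrite -[d in d%:R]card_ord -sum1_card natr_sum mulr_suml ler_sum// => i _.
  by rewrite mul1r.
rewrite exprMn ler_wpM2r ?sqr_ge0// expr2 -natrM ler_nat.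
by case: (d) => // n; exact: leq_pmull.
Qed.

Lemma euclidean_norm0 : euclidean_norm (0 : 'cV[R]_d) = 0.
Proof. by rewrite /euclidean_norm big1 ?sqrtr0// => i _; rewrite mxE expr0n. Qed.

End Euclidean.

(** Match the points with equal codes.  If the codes of two points first differ
    at index n, the distances in both sets lie between [v ^+ n] and [u ^+ n] up
    to constants, and the assumption on [u] and [v] makes these two rates
    eta-Hoelder comparable. *)
Lemma coded_nearly_lipschitz (R : realType) (d : nat) (E F : set 'cV[R]_d) B u v eta :
  (0 < d)%N -> 0 < eta < 1 -> 0 < u < 1 -> 0 < v -> u <= v `^ eta ->
  coded E B u v -> coded F B u v ->
  exists sigma : 'cV[R]_d -> 'cV[R]_d, exists C : R,
      [/\ set_bij E F sigma, 0 < C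
        & forall x y, E x -> E y ->
            C^-1 * euclidean_norm (x - y) `^ (1 / eta)
              <= euclidean_norm (sigma x - sigma y)
              <= C * euclidean_norm (x - y) `^ eta].
Proof.
move=> d0 /andP[eta0 eta1] /andP[u0 u1] v0 uv [code [C [c [[C0 c0] codeB codeS close far]]]].
move=> [code' [C' [c' [[C'0 c'0] codeB' codeS' close' far']]]].
have /choice[sigma sigmaP] : forall x, exists y, E x -> F y /\ forall n, code' y n = code x n.
  move=> x; have [Ex|nEx] := pselect (E x); last by exists x.
  have [y Fy yx] := codeS' (code x) (fun n => codeB x n Ex).
  by exists y.
have sep (G : set 'cV[R]_d) (cd : 'cV[R]_d -> nat -> nat) D x y : G x -> G y ->
    (forall x y n, G x -> G y -> (forall i, (i < n)%N -> cd x i = cd y i) ->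
      `|x - y| <= D * u ^+ n) -> (forall n, cd x n = cd y n) -> x = y.
  move=> Gx Gy cl xy; apply/eqP; rewrite -subr_eq0 -normr_le0.
  have D0 : (fun n => D * u ^+ n) @ \oo --> (0 : R).
    rewrite -[X in _ --> X](mulr0 D); apply: cvgMr; apply: cvg_expr.
    by rewrite ger0_norm// ltW.
  rewrite -(cvg_lim _ D0)//; apply: limr_ge; first by apply/cvg_ex; exists 0.
  by apply: nearW => n; apply: cl.
have dR0 : 0 < d%:R :> R by rewrite ltr0n.
pose C1 := d%:R * C' * c^-1 `^ eta.
pose C2 := c'^-1 * (d%:R * C) `^ (1 / eta).
have C10 : 0 < C1 by rewrite !mulr_gt0// powR_gt0// invr_gt0.
have C20 : 0 < C2 by rewrite mulr_gt0 ?invr_gt0// powR_gt0// mulr_gt0.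
exists sigma, (C1 + C2); split; last 2 first.
- exact: addr_gt0.
- move=> x y Ex Ey; have [Fx xc] := sigmaP x Ex; have [Fy yc] := sigmaP y Ey.
  have [->|/eqP xy] := eqVneq x y.
    by rewrite !subrr euclidean_norm0 !powR0 ?mulr0 ?lexx ?gt_eqF// divr_gt0.
  have exn : exists n, code x n != code y n.
    apply: contrapT => H; apply: xy; apply: (sep E code C) => // n.
    by apply/eqP/negPn/negP => nn; apply: H; exists n.
  case: (ex_minnP exn) => n /eqP nxy nmin.
  have agree i : (i < n)%N -> code x i = code y i.
    move=> i_n; apply/eqP/negPn/negP => /nmin; by rewrite leqNgt i_n.
  have agree' i : (i < n)%N -> code' (sigma x) i = code' (sigma y) i.
    by move=> /agree; rewrite xc yc.
  have nxy' : code' (sigma x) n <> code' (sigma y) n by rewrite xc yc.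
  have b1 := close _ _ _ Ex Ey agree; have b2 := far _ _ _ Ex Ey agree nxy.
  have b3 := close' _ _ _ Fx Fy agree'; have b4 := far' _ _ _ Fx Fy agree' nxy'.
  have eta_ne : eta != 0 by rewrite gt_eqF.
  apply/andP; split.
    have e1 : euclidean_norm (x - y) <= d%:R * C * u ^+ n.
      by apply: (le_trans (euclidean_le_norm _)); rewrite -mulrA ler_wpM2l.
    have e2 : euclidean_norm (x - y) `^ (1 / eta) <= (d%:R * C) `^ (1 / eta) * v ^+ n.
      apply: le_trans (ge0_ler_powR _ _ _ e1) _; rewrite ?nnegrE ?sqrtr_ge0 ?divr_ge0 ?(ltW eta0)//.
        by rewrite !mulr_ge0 ?exprn_ge0 ?(ltW C0) ?(ltW u0)//.
      rewrite powRM ?mulr_ge0 ?exprn_ge0 ?(ltW C0) ?(ltW u0)// ler_wpM2l ?powR_ge0//.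
      rewrite -powR_mulrn ?(ltW u0)// -powRrM mulrC powRrM powR_mulrn ?powR_ge0//.
      apply: lerXn2r; rewrite ?nnegrE ?powR_ge0 ?(ltW v0)//.
      have -> : v = (v `^ eta) `^ (1 / eta) by rewrite -powRrM mulrC divfK// powRr1// ltW.
      by apply: ge0_ler_powR; rewrite ?nnegrE ?powR_ge0 ?divr_ge0 ?(ltW u0) ?(ltW eta0).
    apply: (@le_trans _ _ (C2^-1 * ((d%:R * C) `^ (1 / eta) * v ^+ n))).
      rewrite ler_pM ?invr_ge0 ?powR_ge0 ?addr_ge0 ?(ltW C10) ?(ltW C20)//.
      by rewrite lef_pV2 ?posrE ?addr_gt0// lerDr ltW.
    rewrite /C2 invfM invrK !mulrA divfK ?gt_eqF ?powR_gt0 ?mulr_gt0//.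
    exact: le_trans b4 (norm_le_euclidean _).
  have e1 : c * v ^+ n <= euclidean_norm (x - y) := le_trans b2 (norm_le_euclidean _).
  apply: le_trans (euclidean_le_norm _) _.
  apply: (@le_trans _ _ (d%:R * (C' * u ^+ n))); first by rewrite ler_wpM2l.
  apply: (@le_trans _ _ (C1 * euclidean_norm (x - y) `^ eta)); last first.
    by rewrite ler_wpM2r ?powR_ge0// lerDl ltW.
  rewrite /C1 -!mulrA !ler_wpM2l ?(ltW C'0)// -powRM ?invr_ge0 ?sqrtr_ge0 ?(ltW c0)//.
  apply: (@le_trans _ _ ((v `^ eta) ^+ n)).
    by apply: lerXn2r; rewrite ?nnegrE ?powR_ge0 ?(ltW u0).
  rewrite -powR_mulrn ?powR_ge0// -powRrM mulrC powRrM powR_mulrn ?(ltW v0)//.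
  apply: ge0_ler_powR; rewrite ?nnegrE ?exprn_ge0 ?(ltW eta0) ?(ltW v0)//.
    by rewrite mulr_ge0 ?invr_ge0 ?sqrtr_ge0 ?(ltW c0).
  by rewrite mulrC ler_pdivlMr// mulrC.
split.
- by move=> x Ex /=; have [] := sigmaP x Ex.
- move=> x y; rewrite !inE => Ex Ey sxy; apply: (sep E code C) => // n.
  by have [_ <-] := sigmaP x Ex; rewrite sxy; have [_ ->] := sigmaP y Ey.
- move=> y Fy; have [x Ex xy] := codeS (code' y) (fun n => codeB' y n Fy).
  exists x => //; have [Fx sx] := sigmaP x Ex.
  by apply: (sep F code' C') => // n; rewrite sx.
Qed.

(** * Pieces of a self-affine set *)

Section Words.
Variables (R : realType) (n : nat) (A : 'M[int]_n.+1).
Variables (T : finType) (dig : T -> 'cV[int]_n.+1).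

Local Notation M := (map_mx (intmul 1) A : 'M[R]_n.+1).
Local Notation toR := (map_mx (intmul 1) : 'cV[int]_n.+1 -> 'cV[R]_n.+1).

(** The head of a word is its finest digit: prepending a digit refines the
    piece, dropping a prefix coarsens it. *)
Fixpoint word_val (I : seq T) : 'cV[int]_n.+1 :=
  if I is e :: I' then A *m word_val I' + dig e else 0.

(** The copy [M^-k (K + v)] of [K], where k is the length and v the value of the
    word, written without inverse matrices. *)
Definition piece (K : set 'cV[R]_n.+1) (I : seq T) : set 'cV[R]_n.+1 :=
  fun x => K (M ^+ size I *m x - toR (word_val I)).

Lemma word_step e I (x : 'cV[R]_n.+1) :
  M ^+ size (e :: I) *m x - toR (word_val (e :: I)) =
  M *m (M ^+ size I *m x - toR (word_val I)) - toR (dig e).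
Proof.
rewrite /= exprS -[M * _]/(M *m _) map_mxD map_mxM mulmxBr mulmxA.
by rewrite opprD addrA.
Qed.

(** The copies of the open set indexed by distinct words of equal length are
    disjoint; words with the same value would have the same copy.  The two
    assumptions on [O] say that the maps send [O] into itself and have disjoint
    images of it. *)
Lemma osc_word_val_inj (O : set 'cV[R]_n.+1) : M \in unitmx -> O !=set0 ->
  (forall e y, O (M *m y - toR (dig e)) -> O y) ->
  (forall e f y, O (M *m y - toR (dig e)) ->
    O (M *m y - toR (dig f)) -> e = f) ->
  forall I J, size I = size J -> word_val I = word_val J -> I = J.
Proof.
move=> Mu [p Op] Osub Odis I J sIJ vIJ.
have key I1 J1 x : size I1 = size J1 -> piece O I1 x -> piece O J1 x -> I1 = J1.
  elim: I1 J1 => [|e I1 IH] [|f J1] //= [sIJ1].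
  rewrite /piece !word_step => OI OJ.
  have IJ : I1 = J1 by apply: IH sIJ1 _ _; [exact: Osub OI|exact: Osub OJ].
  by move: OI OJ; rewrite IJ => OI OJ; rewrite (Odis _ _ _ OI OJ).
have Xu : M ^+ size I \in unitmx by elim: (size I) => [|k IH]; [exact: unitmx1|rewrite exprS unitmx_mul Mu].
apply: (key _ _ (invmx (M ^+ size I) *m (p + toR (word_val I)))) => //.
  by rewrite /piece mulKVmx// addrK.
by rewrite /piece -sIJ -vIJ mulKVmx// addrK.
Qed.

Variable K : set 'cV[R]_n.+1.
Hypothesis Mu : M \in unitmx.
Hypothesis K_digit : forall y, K y <-> exists e, K (M *m y - toR (dig e)).

Lemma piece_cons I x : piece K I x <-> exists e, piece K (e :: I) x.
Proof.
split=> [/K_digit[e Ke]|[e]].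
  by exists e; rewrite /piece word_step.
by rewrite /piece word_step => Ke; apply/K_digit; exists e.
Qed.

Lemma piece_cat u I x : piece K (u ++ I) x -> piece K I x.
Proof. by elim: u => //= e u IH uI; apply: IH; apply/piece_cons; exists e. Qed.

Lemma piece_extend j I x : piece K I x -> exists u : j.-tuple T, piece K (u ++ I) x.
Proof.
move=> Ix; elim: j => [|j [u /piece_cons[e eu]]]; first by exists [tuple].
by exists [tuple of e :: u].
Qed.

Lemma piece_nil x : piece K [::] x <-> K x.
Proof. by rewrite /piece expr0 mul1mx map_mx0 subr0. Qed.

Lemma piece_sub I x : piece K I x -> K x.
Proof. by rewrite -{1}[I]cats0 => /piece_cat /piece_nil. Qed.

Lemma piece_exists k x : K x -> exists I : k.-tuple T, piece K I x.
Proof. by move=> /piece_nil /(piece_extend k)[u]; rewrite cats0; exists u. Qed.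

Lemma invmx_exp k : M ^+ k *m invmx M ^+ k = 1%:M.
Proof.
elim: k => [|k IH]; first by rewrite !expr0 mulmx1.
rewrite exprSr exprS -[M ^+ k * M]/(M ^+ k *m M) -[invmx M * _]/(invmx M *m _).
by rewrite mulmxA -[M ^+ k *m M *m _]mulmxA mulmxV// mulmx1.
Qed.

Lemma invmx_expl k : invmx M ^+ k *m M ^+ k = 1%:M.
Proof. by apply: mulmx1C; exact: invmx_exp. Qed.

Lemma piece_neq0 I : K !=set0 -> piece K I !=set0.
Proof.
move=> [x Kx]; exists (invmx M ^+ size I *m (x + toR (word_val I))).
by rewrite /piece mulmxA invmx_exp mul1mx addrK.
Qed.

Lemma mulmx_expK k x : invmx M ^+ k *m (M ^+ k *m x) = x :> 'cV[R]_n.+1.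
Proof. by rewrite mulmxA invmx_expl mul1mx. Qed.

End Words.

Lemma finite_lattice_ball (R : realType) d (r : R) : exists s : seq 'cV[int]_d,
  forall z : 'cV[int]_d, `|map_mx (intmul 1) z : 'cV[R]_d| <= r -> z \in s.
Proof.
pose m := Num.truncn r.
exists [seq (\col_i ((f i : nat)%:Z - m%:Z)) | f : {ffun 'I_d -> 'I_(m + m).+1}] => z zr.
have zm i : (`|z i 0%R| <= m)%N.
  rewrite /m truncn_ge_nat; last first.
    by apply: le_trans zr.
  rewrite natr_absz intr_norm.
  apply: le_trans zr; rewrite [leRHS]/Num.Def.normr/= mx_normrE.
  by apply/bigmax_geP; right; exists (i, ord0) => //=; rewrite mxE.
apply/mapP; exists [ffun i => inord (absz (z i 0 + m%:Z))]; first by rewrite mem_enum.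
apply/colP => i; rewrite !mxE ffunE inordK; have := zm i; move: (z i 0) => w; clear; move: (m) => p; lia.
Qed.

(** * Clusters of touching pieces *)

Section Clusters.
Variables (R : realType) (n : nat) (A : 'M[int]_n.+1).
Variables (T : finType) (dig : T -> 'cV[int]_n.+1) (K : set 'cV[R]_n.+1).
Variables (alpha rho Ca Cb : R).

Local Notation M := (map_mx (intmul 1) A : 'M[R]_n.+1).
Local Notation toR := (map_mx (intmul 1) : 'cV[int]_n.+1 -> 'cV[R]_n.+1).
Local Notation val := (word_val A dig).
Local Notation piece := (piece A dig K).

Hypothesis M_unit : M \in unitmx.
Hypothesis K_digit : forall y, K y <-> exists e, K (M *m y - toR (dig e)).
Hypothesis K_neq0 : K !=set0.
Hypothesis K_compact : compact K.
Hypothesis K_tdisc : totally_disconnected K.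
Hypothesis word_inj : forall I J, size I = size J -> val I = val J -> I = J.
Hypothesis rho_gt1 : 1 < rho.
Hypothesis alpha01 : 0 < alpha < 1.
Hypothesis Ca_gt0 : 0 < Ca.
Hypothesis Cb_gt0 : 0 < Cb.
Hypothesis M_growth : forall k (x : 'cV[R]_n.+1), `|M ^+ k *m x| <= Ca * rho ^+ k * `|x|.
Hypothesis Minv_growth : forall k (x : 'cV[R]_n.+1), `|invmx M ^+ k *m x| <= Cb * alpha ^+ k * `|x|.

Lemma norm_le_mulmx_exp k (x : 'cV[R]_n.+1) : `|x| <= Cb * alpha ^+ k * `|M ^+ k *m x|.
Proof. by rewrite -[X in `|X| <= _](mulmx_expK M_unit k) Minv_growth. Qed.

Definition touch k (I J : k.-tuple T) : bool := `[< exists x, piece I x /\ piece J x >].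

Lemma touchP k (I J : k.-tuple T) x : piece I x -> piece J x -> touch I J.
Proof. by move=> Ix Jx; apply/asboolP; exists x. Qed.

Lemma connect_touch_sym k : connect_sym (@touch k).
Proof.
by apply: sym_connect_sym => I J; apply/asboolP/asboolP => -[x [? ?]]; exists x.
Qed.

Lemma piece_behead k (L : k.+1.-tuple T) x : piece L x -> piece (behead_tuple L) x.
Proof. by rewrite {1}(tuple_eta L) => Lx; apply/piece_cons => //; exists (thead L). Qed.

Lemma connect_behead k (I J : k.+1.-tuple T) : connect (@touch k.+1) I J ->
  connect (@touch k) (behead_tuple I) (behead_tuple J).
Proof.
move=> /connectP[p + ->]; elim: p I => //= L p IH I /andP[IL /IH].
apply: connect_trans; apply: connect1.
by move: IL => /asboolP[x [Ix Lx]]; apply: (@touchP _ _ _ x); exact: piece_behead.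
Qed.

Lemma K_bounded : exists2 b, 0 < b & forall x, K x -> `|x| <= b.
Proof.
have [b [_ Hb]] := compact_bounded K_compact.
exists (`|b| + 1); first by rewrite ltr_wpDl.
by move=> x Kx; apply: (Hb _ _ x Kx); rewrite (le_lt_trans (ler_norm _))// ltrDl.
Qed.

Lemma alpha_small e : 0 < e -> exists k, Cb * alpha ^+ k < e.
Proof.
move=> e0; have /andP[a0 a1] := alpha01.
have : (fun k => Cb * alpha ^+ k) @ \oo --> (0 : R).
  rewrite -[X in _ --> X](mulr0 Cb); apply: cvgMr; apply: cvg_expr.
  by rewrite ger0_norm// ltW.
move=> /cvgr0Pnorm_lt /(_ e e0)[k _ Hk]; exists k.
by have := Hk k (leqnn k); rewrite ger0_norm// mulr_ge0 ?exprn_ge0// ltW.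
Qed.

(** Fix m such that pieces of relative level m are smaller than the scale at
    which chains have diameter less than 1 in the union of the integer
    translates of [K] that lie within a bounded window.  Look at a component of
    level k through M^(k-m): its pieces are then translates of
    the image of [K] under M^-m, lie in integer translates of [K], and
    successive ones touch.  As long as the path of pieces
    stays in the window it moves by less than 1, so it never leaves the
    window. *)
Lemma connected_words_close : exists2 r, 0 < r & forall k (I J : k.-tuple T),
  connect (@touch k) I J -> `|toR (val I) - toR (val J)| <= r.
Proof.
have [b b0 Kb] := K_bounded.
have Kbb x y : K x -> K y -> `|x - y| <= b + b.
  by move=> Kx Ky; rewrite (le_trans (ler_normB _ _))// lerD// Kb.
have [s sP] := finite_lattice_ball n.+1 (2 + (b + b)).
have [e e0 He] := chain_bounded_translates s toR
  (chain_bounded_tdisc K_compact K_tdisc) ltr01.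
set S := (X in chain X) in He.
have e1 : 0 < Num.min e 1 by rewrite lt_min e0 ltr01.
have [m Hm] := alpha_small (divr_gt0 e1 (addr_gt0 b0 b0)).
exists (Ca * rho ^+ m * (1 + (b + b)) + (b + b)).
  by rewrite !(addr_gt0, mulr_gt0)// exprn_gt0// (lt_trans ltr01).
move=> k I J IJ.
have [p0 Ip0] := piece_neq0 dig M_unit I K_neq0.
have [p Jp] := piece_neq0 dig M_unit J K_neq0.
have spread l (x : 'cV[R]_n.+1) : (l <= m)%N -> `|M ^+ l *m x| <= Ca * rho ^+ m * `|x|.
  move=> lm; apply: (le_trans (M_growth _ _)).
  by rewrite ler_wpM2r// ler_wpM2l ?(ltW Ca_gt0)// ler_weXn2l// ltW.
have rm0 : 0 <= Ca * rho ^+ m by rewrite mulr_ge0 ?exprn_ge0 ?(ltW Ca_gt0)// ltW// (lt_trans ltr01).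
suff Mk : `|M ^+ k *m (p - p0)| <= Ca * rho ^+ m * (1 + (b + b)).
  have Eq : toR (val I) - toR (val J) =
      ((M ^+ size J *m p - toR (val J)) - (M ^+ size I *m p0 - toR (val I)))
       - M ^+ k *m (p - p0).
    rewrite !size_tuple mulmxBr; move: (M ^+ k *m p) (M ^+ k *m p0) => P P0.
    by apply/colP => i; rewrite !mxE; ring.
  by rewrite Eq (le_trans (ler_normB _ _))// addrC lerD// Kbb.
(* At the finitely many levels k <= m the diameter of K is bound enough. *)
have [km|mk] := leqP k m.
  apply: (le_trans (spread _ _ km)); rewrite ler_wpM2l//.
  have := Kbb _ _ (piece_sub K_digit Jp) (piece_sub K_digit Ip0); lra.
have kE : k = (m + (k - m))%N by rewrite subnKC// ltnW.
set l := (k - m)%N in kE.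
pose z (L : k.-tuple T) := toR (val (drop m L)).
have zP (L : k.-tuple T) x : piece L x -> K (M ^+ l *m x - z L).
  rewrite -{1}(cat_take_drop m L) => /(piece_cat K_digit).
  by rewrite /piece size_drop size_tuple.
(* Positions after rescaling, relative to the translate that contains I. *)
pose q x := M ^+ l *m x - z I.
have qB x y : q x - q y = M ^+ l *m (x - y) by rewrite /q opprB addrA subrK mulmxBr.
have step (L : k.-tuple T) x y : piece L x -> piece L y -> `|q x - q y| < Num.min e 1.
  move=> Lx Ly; rewrite qB (le_lt_trans (norm_le_mulmx_exp m _))//.
  have -> : M ^+ m *m (M ^+ l *m (x - y)) =
      (M ^+ size L *m x - toR (val L)) - (M ^+ size L *m y - toR (val L)).
    rewrite mulmxA -[M ^+ m *m M ^+ l]/(M ^+ m * M ^+ l) -exprD -kE size_tuple.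
    by rewrite opprB addrA subrK mulmxBr.
  have a0 : 0 <= Cb * alpha ^+ m.
    by have /andP[/ltW ? _] := alpha01; rewrite mulr_ge0 ?exprn_ge0 ?(ltW Cb_gt0).
  apply: (@le_lt_trans _ _ (Cb * alpha ^+ m * (b + b))).
    by rewrite ler_wpM2l// Kbb.
  by rewrite -ltr_pdivlMr// addr_gt0.
have Sq (L : k.-tuple T) x : piece L x -> `|q x - q p0| <= 2 -> S (q x).
  move=> Lx xp0; exists (val (drop m L) - val (drop m I)); last first.
    by rewrite map_mxB /q opprB addrA subrK; exact: zP.
  apply: sP; rewrite map_mxB -/(z L) -/(z I).
  have -> : z L - z I = (q x - q p0) + (q p0 - (M ^+ l *m x - z L)).
    by rewrite /q; move: (M ^+ l *m x) => X; rewrite subrKA; apply/colP => i; rewrite !mxE; ring.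
  rewrite (le_trans (ler_normD _ _))// lerD// Kbb//; exact: zP.
have claim L : connect (@touch k) I L -> forall x, piece L x -> chain S e (q p0) (q x).
  move=> /connectP[t + ->]; elim/last_ind: t => [_ x /= Ix|t L' IH].
    have p0x := step _ _ _ Ip0 Ix.
    have lt2 : `|q p0 - q x| <= 2 by apply: ltW; apply: lt_le_trans p0x _; rewrite ge_min; lra.
    apply: (@chain_step _ _ _ _ _ (q p0)).
    - by apply: chain_refl; apply: (Sq I) => //; rewrite subrr normr0.
    - by apply: (Sq I) => //; rewrite distrC.
    - by apply: lt_le_trans p0x _; rewrite ge_min lexx.
  rewrite last_rcons rcons_path => /andP[/IH {}IH /asboolP[y [Ly L'y]]] x L'x.
  have yx := step _ _ _ L'y L'x.
  apply: (chain_step (IH y Ly)); last by apply: lt_le_trans yx _; rewrite ge_min lexx.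
  apply: (Sq L') => //; have := He _ _ (IH y Ly).
  have yx1 : `|q y - q x| < 1 by apply: lt_le_trans yx _; rewrite ge_min lexx orbT.
  have -> : q x - q p0 = - (q y - q x) - (q p0 - q y).
    by move: (q x) (q y) (q p0) => qx qy q0; rewrite !opprB subrKA.
  by have := ler_normB (- (q y - q x)) (q p0 - q y); rewrite normrN; lra.
have := He _ _ (claim J IJ p Jp).
rewrite distrC qB => q1.
rewrite [in M ^+ k]kE exprD -[_ * _]/(M ^+ m *m M ^+ l) -mulmxA (le_trans (spread _ _ (leqnn m)))//.
rewrite ler_wpM2l//; lra.
Qed.

(** Distinct words of a component have distinct values, and these lie in an
    integer ball of fixed radius. *)
Lemma component_card : exists m, forall k (I : k.-tuple T),
  (#|[set J | connect (@touch k) I J]%SET| <= m)%N.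
Proof.
have [r r0 Hr] := connected_words_close.
have [s sP] := finite_lattice_ball n.+1 r.
exists (size s) => k I; rewrite cardE.
rewrite -(size_map (fun J : k.-tuple T => val I - val J)); apply: uniq_leq_size.
  rewrite map_inj_uniq ?enum_uniq// => J L /(congr1 (fun v => val I - v)).
  by rewrite /= !subKr => JL; apply/val_inj/word_inj; rewrite ?size_tuple.
move=> v /mapP[J + ->]; rewrite mem_enum inE => IJ; apply: sP.
by rewrite map_mxB; exact: Hr.
Qed.

(** After rescaling, two pieces are integer translates of [K]; up to a common
    translation there are only finitely many pairs of them at distance less
    than 1, and each disjoint pair of compact sets has a positive distance. *)
Lemma untouched_gap : exists2 e, 0 < e & forall k (I J : k.-tuple T) x y,
  piece I x -> piece J y -> ~~ touch I J -> e <= `|M ^+ k *m (x - y)|.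
Proof.
have [b b0 Kb] := K_bounded.
have [s sP] := finite_lattice_ball n.+1 (1 + (b + b)).
have clK : closed K by apply: compact_closed => //; exact: norm_hausdorff.
have gap (w : 'cV[int]_n.+1) : exists2 e, 0 < e &
    (exists a c, [/\ K a, K c & a = c - toR w]) \/
    forall a c, K a -> K c -> e <= `|a - (c - toR w)|.
  pose K' := (fun x => x + toR w) @^-1` K.
  have [meet|nomeet] := pselect (exists a c, [/\ K a, K c & a = c - toR w]).
    by exists 1 => //; left.
  have clK' : closed K'.
    have cf : continuous (fun x : 'cV[R]_n.+1 => x + toR w); last exact: (continuous_closedP _).1 cf _ clK.
    move=> x; by apply: (@continuousD R _ _ id (fun=> toR w)); [exact: cvg_id|exact: cst_continuous].
  have [|e e0 He] := compact_closed_gap K_compact clK'.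
    apply/seteqP; split=> // a [Ka K'a]; apply: nomeet.
    by exists a, (a + toR w); split=> //; rewrite addrK.
  exists e => //; right=> a c Ka Kc; apply: He => //.
  by rewrite /K' /= subrK.
have [e [e0 e1 He]] : exists e, [/\ 0 < e, e <= 1 & forall w, w \in s ->
    (exists a c, [/\ K a, K c & a = c - toR w]) \/
    forall a c, K a -> K c -> e <= `|a - (c - toR w)|].
  elim: (s) => [|w s' [e [e0 e1 He]]]; first by exists 1; split.
  have [e' e'0 He'] := gap w; exists (Num.min e e'); split.
  - by rewrite lt_min e0.
  - by rewrite ge_min e1.
  move=> w'; rewrite inE => /orP[/eqP->|/He [|H]]; first case: He'.
  - by left.
  - by move=> H; right=> a c Ka Kc; rewrite ge_min H ?orbT.
  - by left.
  - by right=> a c Ka Kc; rewrite ge_min H.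
exists e => // k I J x y Ix Jy nIJ; rewrite leNgt; apply/negP => small.
set a := M ^+ size I *m x - toR (val I) in Ix *.
pose c := M ^+ size J *m y - toR (val J).
have acE : M ^+ k *m (x - y) = a - (c - toR (val I - val J)).
  rewrite /a /c !size_tuple mulmxBr map_mxB.
  move: (M ^+ k *m x) (M ^+ k *m y) => X Y; apply/colP => i; rewrite !mxE; ring.
have : val I - val J \in s.
  apply: sP; have -> : toR (val I - val J) = M ^+ k *m (x - y) - (a - c).
    by rewrite acE; move: (a) (c) => a' c'; apply/colP => i; rewrite !mxE; ring.
  rewrite (le_trans (ler_normB _ _))// lerD//; first by rewrite ltW// (lt_le_trans small).
  by rewrite (le_trans (ler_normB _ _))// lerD// Kb.
move=> /He[[a' [c' [Ka' Kc' ac]]]|H]; last first.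
  by move: small; rewrite acE ltNge H.
move/negP: nIJ; apply; apply: (@touchP _ _ _ (invmx M ^+ k *m (a' + toR (val I)))).
  by rewrite /piece size_tuple mulmxA invmx_exp// mul1mx addrK.
rewrite /piece size_tuple mulmxA invmx_exp// mul1mx ac map_mxB.
rewrite (_ : _ - _ = c')//; apply/colP => i; rewrite !mxE; ring.
Qed.

(** A point may lie in several pieces of level k, but these touch, so the root
    of their component is well defined; it names the cell of the point.  The
    digit [e0] only serves for points outside [K]. *)
Definition word_label e0 k (x : 'cV[R]_n.+1) : k.-tuple T :=
  fingraph.root (@touch k) (odflt (nseq_tuple k e0) [pick I : k.-tuple T | `[< piece I x >]]).

Lemma word_labelE e0 k (I : k.-tuple T) x : piece I x -> word_label e0 k x = fingraph.root (@touch k) I.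
Proof.
move=> Ix; rewrite /word_label; case: pickP => [J /asboolP Jx|/(_ I)/asboolP//] /=.
apply/(fingraph.rootP (@connect_touch_sym k)); apply: connect1; exact: touchP Jx Ix.
Qed.

Lemma word_label_eq e0 k (I J : k.-tuple T) x y : piece I x -> piece J y ->
  word_label e0 k x = word_label e0 k y -> connect (@touch k) I J.
Proof.
move=> Ix Jy; rewrite (word_labelE _ Ix) (word_labelE _ Jy).
by move/(fingraph.rootP (@connect_touch_sym k)).
Qed.

(** The cells are the fibres of [word_label].  They are counted by pieces: there
    are #|T|^j words of level j+k extending a given word of level k, and
    components have a bounded number of words. *)
Lemma self_affine_coded : (1 < #|T|)%N -> exists t, forall L, (t <= L)%N ->
  coded K (#|T| ^ L) (alpha ^+ (L - t)) (rho^-1 ^+ (L + t)).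
Proof.
move=> T2; have [e0 _] : exists e0 : T, true by case/card_gt0P: (ltnW T2) => e0; exists e0.
have [m Hm] := component_card.
have [r r0 Hr] := connected_words_close.
have [g g0 Hg] := untouched_gap.
have [b b0 Kb] := K_bounded.
have /andP[a0 a1] := alpha01.
have rho0 : 0 < rho := lt_trans ltr01 rho_gt1.
have pieceK := fun I x => @piece_sub _ _ _ _ dig K K_digit I x.
have pieceE k x : K x -> exists I : k.-tuple T, piece I x := piece_exists K_digit k (x := x).
pose par k (l : k.+1.-tuple T) : k.-tuple T := fingraph.root (@touch k) (behead_tuple l).
apply: (@cell_tree_coded _ _ K _ (word_label e0) par #|T| m
  (Cb * (r + (b + b))) (g / Ca) alpha rho^-1) => //.
- move=> k x /(pieceE k.+1)[I Ix].
  rewrite (word_labelE _ (piece_behead Ix)) (word_labelE _ Ix); apply/(fingraph.rootP (@connect_touch_sym k)).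
  by apply: connect_behead; exact: connect_root.
- by move=> x y _ _; rewrite [LHS]tuple0 [RHS]tuple0.
- move=> j k x Kx; have [I Ix] := pieceE k x Kx.
  pose f (p : k.-tuple T * j.-tuple T) : (j + k).-tuple T :=
    fingraph.root (@touch (j + k)) (cat_tuple p.2 p.1).
  pose D := finset.setX [set J | connect (@touch k) I J]%SET [set: j.-tuple T]%SET.
  apply: (@leq_trans #|[set f p | p in D]%SET|).
    apply/subset_leq_card/fintype.subsetP => l /labelsE[y [Ky yx] <-].
    have [J Jy] := pieceE k y Ky; have [u uy] := piece_extend K_digit j Jy.
    apply/imsetP; exists (J, u); last by rewrite (@word_labelE e0 _ (cat_tuple u J)).
    by rewrite !inE andbT; exact: word_label_eq Ix Jy (esym yx).
  apply: leq_trans (leq_imset_card _ _) _.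
  by rewrite cardsX cardsT card_tuple leq_mul2r Hm orbT.
- move=> j k x Kx; have [I Ix] := pieceE k x Kx.
  pose f (u : j.-tuple T) : (j + k).-tuple T := fingraph.root (@touch (j + k)) (cat_tuple u I).
  set D := labels _ _ _.
  have fD u : f u \in D.
    have [y uy] := piece_neq0 dig M_unit (cat_tuple u I) K_neq0.
    have Iy := piece_cat K_digit uy.
    rewrite /f -(word_labelE e0 uy); apply: labelsP; split; first exact: pieceK Iy.
    by rewrite (word_labelE _ Ix) (word_labelE _ Iy).
  have -> : (#|T| ^ j = \sum_(u : j.-tuple T) 1)%N by rewrite sum1_card card_tuple.
  rewrite (partition_big f (mem D))//= mulnC -sum_nat_const.
  apply: leq_sum => l lD; rewrite sum1_card; apply: leq_trans (Hm _ l).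
  rewrite -(card_in_imset (f := fun u => cat_tuple u I)).
    apply/subset_leq_card/fintype.subsetP => w /imsetP[u ful ->]; rewrite inE.
    have <- : f u = l by apply/eqP; exact: ful.
    by rewrite connect_touch_sym; exact: connect_root.
  move=> u v _ _ /(congr1 (fun t : (j + k).-tuple T => tval t)) /= /eqP.
  by rewrite eqseq_cat ?size_tuple// => /andP[/eqP uv _]; exact: val_inj.
- by rewrite mulr_gt0// !addr_gt0.
- by rewrite divr_gt0.
- by rewrite a0 ltW.
- by rewrite invr_gt0 rho0 invf_le1// ltW.
- move=> k x y Kx Ky xy; have [I Ix] := pieceE k x Kx; have [J Jy] := pieceE k y Ky.
  apply: (le_trans (norm_le_mulmx_exp k _)).
  rewrite mulrAC ler_wpM2r ?exprn_ge0 ?(ltW a0)// ler_wpM2l ?(ltW Cb_gt0)//.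
  have -> : M ^+ k *m (x - y) = (toR (val I) - toR (val J)) +
     ((M ^+ size I *m x - toR (val I)) - (M ^+ size J *m y - toR (val J))).
    rewrite !size_tuple mulmxBr; move: (M ^+ k *m x) (M ^+ k *m y) => X Y.
    by apply/colP => i; rewrite !mxE; ring.
  rewrite (le_trans (ler_normD _ _))// lerD//.
    by apply: Hr; exact: word_label_eq xy.
  by rewrite (le_trans (ler_normB _ _))// lerD// Kb.
- move=> k x y Kx Ky xy; have [I Ix] := pieceE k x Kx; have [J Jy] := pieceE k y Ky.
  have nIJ : ~~ touch I J.
    apply/negP => IJ; apply: xy; rewrite (word_labelE _ Ix) (word_labelE _ Jy).
    by apply/(fingraph.rootP (@connect_touch_sym k)); exact: connect1.
  have := le_trans (Hg _ _ _ _ _ Ix Jy nIJ) (M_growth _ _).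
  by move=> gle; rewrite exprVn -mulrA -invfM ler_pdivrMr ?mulr_gt0 ?exprn_gt0// mulrC.
Qed.

End Clusters.

(** * The common modulus of the eigenvalues *)

Lemma ltr_powR (R : realType) (r s t : R) : 1 < r -> s < t -> r `^ s < r `^ t.
Proof.
move=> r1 st; have r0 : 0 < r := lt_trans ltr01 r1.
by rewrite /powR !gt_eqF// ltr_expR ltr_pM2r// ln_gt0.
Qed.

Definition power_growth (R : realType) n (X : 'M[R]_n.+1) (r : R) :=
  forall rho, r < rho -> exists2 C, 0 < C &
    forall k (x : 'cV[R]_n.+1), `|X ^+ k *m x| <= C * rho ^+ k * `|x|.

Section Modulus.
Variables (R : realType) (n : nat) (A : 'M[int]_n.+1).

Local Notation M := (map_mx (intmul 1) A : 'M[R]_n.+1).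

Let map_real_complex : map_mx (real_complex R) M = map_mx (intmul 1) A.
Proof. by apply/matrixP => i j; rewrite !mxE rmorph_int. Qed.

Lemma expanding_unit : expanding R A -> M \in unitmx.
Proof.
move=> hexp; rewrite -(map_unitmx (real_complex R)) map_real_complex -row_free_unit -kermx_eq0.
apply/negPn/negP => ker; suff /hexp : complex_eigenvalue A (0 : R[i]) by rewrite normr0 ltr10.
by rewrite /complex_eigenvalue /eigenvalue /eigenspace raddf0 subr0.
Qed.

Lemma complex_eigenvalue_exists : exists z : R[i], complex_eigenvalue A z.
Proof.
pose AC := map_mx (intmul 1) A : 'M[R[i]]_n.+1.
have [s chs] := closed_field_poly_normal (char_poly AC).
move: chs; rewrite (monicP (char_poly_monic _)) scale1r => chs.
case: s chs => [|z s] chs.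
  by have := size_char_poly AC; rewrite chs big_nil size_poly1.
by exists z; rewrite /complex_eigenvalue eigenvalue_root_char -/AC chs root_prod_XsubC mem_head.
Qed.

(** The eigenvalues of the inverse are the inverses of the eigenvalues, so all
    of them have modulus [r^-1]. *)
Lemma equal_moduli_growth : expanding R A -> equal_moduli R A -> 
  exists r : R, [/\ 1 < r, power_growth M r & power_growth (invmx M) r^-1].
Proof.
move=> hexp hmod; have Mu := expanding_unit hexp.
have [z0 z0A] := complex_eigenvalue_exists.
have [r rz0] : exists r : R, `|z0| = r%:C%C.
  by rewrite normc_def; eexists.
have r1 : 1 < r by rewrite -ltcR -rz0; exact: hexp.
have r0 : 0 < r := lt_trans ltr01 r1.
exists r; split=> // [rho rrho|alpha ralpha].
  apply: real_eigenvalue_growth; first exact: lt_trans rrho.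
  by move=> z; rewrite map_real_complex => /(hmod _ _ z0A) <-; rewrite rz0 ltcR.
apply: real_eigenvalue_growth; first by apply: lt_trans ralpha; rewrite invr_gt0.
move=> z; rewrite map_invmx map_real_complex => /eigenvalueP[v vA v0].
have AuC : (map_mx (intmul 1) A : 'M[R[i]]_n.+1) \in unitmx.
  by rewrite -map_real_complex map_unitmx.
have vE : v = z *: (v *m map_mx (intmul 1) A).
  by rewrite scalemxAl -vA mulmxKV.
have z_neq0 : z != 0 by apply: contraNneq v0 => z00; rewrite vE z00 scale0r.
have /(hmod _ _ z0A) : complex_eigenvalue A z^-1.
  apply/eigenvalueP; exists v => //.
  by rewrite [in RHS]vE scalerA mulVf// scale1r.
rewrite rz0 normfV => rz; have -> : `|z| = (r^-1)%:C%C.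
  by rewrite -[LHS]invrK -rz fmorphV.
by rewrite ltcR.
Qed.

End Modulus.

Lemma powR_exprn (R : realType) (s e : R) m : 0 <= s -> (s ^+ m) `^ e = (s `^ e) ^+ m.
Proof. by move=> s0; rewrite -!powR_mulrn ?powR_ge0// -!powRrM mulrC. Qed.

Lemma expn_gap a b : (0 < a < b)%N -> exists q, (a ^ q.+1 < b ^ q)%N.
Proof.
move=> /andP[a0 ab].
have bern q : (a ^ q * (a + q.+1) <= a.+1 ^ q.+1)%N.
  elim: q => [|q IH]; first by rewrite expn0 expn1; lia.
  rewrite (expnS _ q.+1) (leq_trans _ (leq_mul (leqnn _) IH))// expnS.
  move: (a ^ q)%N => p; nia.
have [p pE] : exists p, (a ^ 2 = p.+1)%N by exists (a ^ 2).-1; rewrite prednK// expn_gt0 a0.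
exists p.+1; apply: (@leq_trans (a.+1 ^ p.+1)); last by rewrite leq_exp2r.
apply: leq_trans (bern p).
by rewrite -addn2 expnD pE ltn_pmul2l ?expn_gt0 ?a0//; lia.
Qed.

(** * Comparing numbers of digits *)

Section Dimension.
Variables (R : realType) (n : nat) (A : 'M[int]_n.+1).

Local Notation M := (map_mx (intmul 1) A : 'M[R]_n.+1).
Local Notation toR := (map_mx (intmul 1) : 'cV[int]_n.+1 -> 'cV[R]_n.+1).

Lemma same_piece_close (T : finType) (dig : T -> 'cV[int]_n.+1) K b alpha C I x y :
  M \in unitmx -> 0 <= C -> 0 <= alpha ->
  (forall k (x : 'cV[R]_n.+1), `|invmx M ^+ k *m x| <= C * alpha ^+ k * `|x|) ->
  (forall x, K x -> `|x| <= b) -> piece A dig K I x -> piece A dig K I y ->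
  `|x - y| <= C * alpha ^+ size I * (b + b).
Proof.
move=> Mu C0 a0 HC Kb Ix Iy; apply: (le_trans (norm_le_mulmx_exp Mu HC (size I) _)).
rewrite ler_wpM2l ?mulr_ge0 ?exprn_ge0//.
have -> : M ^+ size I *m (x - y) = (M ^+ size I *m x - toR (word_val A dig I))
    - (M ^+ size I *m y - toR (word_val A dig I)).
  by rewrite opprB subrKA mulmxBr.
by rewrite (le_trans (ler_normB _ _))// lerD// Kb.
Qed.

Lemma lattice_norm_ge1 (z : 'cV[int]_n.+1) : z != 0 -> 1 <= `|toR z|.
Proof.
move=> z0; have [i zi] : exists i, z i 0 != 0.
  apply: contrapT => H; move/eqP: z0; apply; apply/colP => i; rewrite mxE.
  by apply/eqP/negPn/negP => zi; apply: H; exists i.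
apply: (@le_trans _ _ `|toR z i 0|).
  by rewrite mxE -intr_norm ler1z; move: zi; rewrite -normr_gt0; lia.
by rewrite [leRHS]/Num.Def.normr/= mx_normrE; apply/bigmax_geP; right; exists (i, 0).
Qed.

Lemma geometric_small (c theta : R) : 0 <= theta < 1 -> exists k, (0 < k)%N && (c * theta ^+ k < 1).
Proof.
move=> /andP[t0 t1].
have : (fun k => c * theta ^+ k) @ \oo --> (0 : R).
  rewrite -[X in _ --> X](mulr0 c); apply: cvgMr; apply: cvg_expr.
  by rewrite ger0_norm.
move=> /cvgr0Pnorm_lt /(_ 1 ltr01)[k _ Hk]; exists k.+1 => /=.
by apply: le_lt_trans (ler_norm _) _; exact: Hk (leqnSn k).
Qed.

(** If N < N', some q has N^(q+1) < N'^q.  Hence two of the N'^(qk) points that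
    are about r^(-qk) apart are mapped by [tau] into one of the N^((q+1)k)
    pieces of diameter about r^(-(q+1)k).  For Hoelder exponents close to 1 this
    is impossible when k is large. *)
Lemma holder_card_le (T T' : finType) (dig : T -> 'cV[int]_n.+1) (dig' : T' -> 'cV[int]_n.+1)
    (K K' : set 'cV[R]_n.+1) r :
  M \in unitmx -> 1 < r ->
  power_growth M r -> power_growth (invmx M) r^-1 ->
  (forall y, K y <-> exists e, K (M *m y - toR (dig e))) ->
  (forall y, K' y <-> exists e, K' (M *m y - toR (dig' e))) ->
  (forall I J, size I = size J -> word_val A dig' I = word_val A dig' J -> I = J) ->
  compact K -> K' !=set0 ->
  (forall eta : R, 0 < eta < 1 -> exists (tau : 'cV[R]_n.+1 -> 'cV[R]_n.+1) (C : R), [/\ 0 < C,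
    forall y, K' y -> K (tau y) & forall y y', K' y -> K' y' ->
     `|y - y'| <= C * `|tau y - tau y'| `^ eta]) ->
  (#|T'| <= #|T|)%N.
Proof.
move=> Mu r1 growth shrink Kdig K'dig inj' cK [x0 K'x0] holder.
rewrite leqNgt; apply/negP => NN'.
have [b b0 Kb] := K_bounded cK.
have N0 : (0 < #|T|)%N.
  have [tau [C [_ tauK _]]] := holder 2^-1 ltac:(lra).
  by have /Kdig[e _] := tauK _ K'x0; apply/card_gt0P; exists e.
have [|q qP] := @expn_gap #|T| #|T'|; first by rewrite N0.
(* With this delta, the exponent (1 + delta) q - (1 - delta)^2 (q + 1) of r in
   theta below is negative. *)
pose delta : R := (4 * q.+1%:R)^-1.
have q1 : 1 <= q.+1%:R :> R by rewrite ler1n.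
have delta0 : 0 < delta by rewrite invr_gt0; lra.
have delta1 : delta <= 4^-1 by rewrite lef_pV2 ?posrE; lra.
have r0 : 0 < r := lt_trans ltr01 r1.
have [Ca Ca0 HCa] := growth (r `^ (1 + delta)) ltac:(by rewrite -[ltLHS](powRr1 (ltW r0)) ltr_powR// ltrDl).
have [Cb Cb0 HCb] := shrink (r `^ (- (1 - delta)))
  ltac:(by rewrite -(powR_inv1 (ltW r0)) ltr_powR//; lra).
have [tau [C [C0 tauK tauH]]] := holder (1 - delta) ltac:(lra).
pose theta : R := (r `^ (1 + delta)) ^+ q * (r `^ (- (1 - delta)) `^ (1 - delta)) ^+ q.+1.
have theta01 : 0 <= theta < 1.
  rewrite mulr_ge0 ?exprn_ge0 ?powR_ge0//= /theta.
  rewrite -!powR_mulrn ?powR_ge0// -!powRrM -powRD; last by rewrite (gt_eqF r0) implybT.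
  rewrite -[ltRHS](powRr0 r) ltr_powR//.
  have dq : 4 * (delta * q.+1%:R) = 1 by rewrite /delta; field; lra.
  have d2 : 0 < delta * (delta * q.+1%:R) by rewrite !mulr_gt0//; lra.
  by rewrite -natr1 in d2 *; lra.
pose c := Ca * C * (Cb * (b + b)) `^ (1 - delta).
have [k /andP[k0 kP]] := geometric_small c theta01.
pose y (I : (q * k).-tuple T') : 'cV[R]_n.+1 := invmx M ^+ (q * k) *m (x0 + toR (word_val A dig' I)).
have yE I : M ^+ (q * k) *m y I = x0 + toR (word_val A dig' I).
  by rewrite /y mulmxA invmx_exp// mul1mx.
have yK I : K' (y I).
  by apply: (piece_sub K'dig (I := I)); rewrite /piece size_tuple yE addrK.
have /choice[w wP] : forall I, exists J : (q.+1 * k).-tuple T, piece A dig K J (tau (y I)).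
  by move=> I; apply: (piece_exists Kdig); exact: tauK.
have [I [J [IJ wIJ]]] : exists I J, I <> J /\ w I = w J.
  apply: contrapT => H; have winj : injective w.
    by move=> I J wIJ; apply: contrapT => IJ; apply: H; exists I, J.
  have := leq_card w winj; rewrite !card_tuple leqNgt !expnM ltn_exp2r// => /negP; exact.
have zIJ : word_val A dig' I - word_val A dig' J != 0.
  rewrite subr_eq0; apply/eqP => vIJ; apply: IJ; apply/val_inj/inj' => //.
  by rewrite !size_tuple.
have := lattice_norm_ge1 zIJ.
rewrite (_ : toR _ = M ^+ (q * k) *m (y I - y J)); last first.
  by rewrite mulmxBr !yE map_mxB; apply/colP => i; rewrite !mxE; ring.
move=> /le_trans /(_ (HCa _ _)) h1.
have h2 := tauH _ _ (yK I) (yK J).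
have h3 : `|tau (y I) - tau (y J)| <= Cb * (r `^ (- (1 - delta))) ^+ (q.+1 * k) * (b + b).
  have := same_piece_close Mu (ltW Cb0) (powR_ge0 _ _) HCb Kb (wP I).
  by rewrite wIJ size_tuple => /(_ _ (wP J)).
have h4 : `|tau (y I) - tau (y J)| `^ (1 - delta) <=
   (Cb * (b + b)) `^ (1 - delta) * ((r `^ (- (1 - delta)) `^ (1 - delta)) ^+ q.+1) ^+ k.
  have s0 := powR_ge0 r (- (1 - delta)).
  have d0 : 0 <= 1 - delta by lra.
  have B0 : 0 <= Cb * (b + b) by rewrite mulr_ge0// ltW// addr_gt0.
  rewrite mulrAC in h3.
  apply: (le_trans (ge0_ler_powR d0 _ _ h3)); rewrite ?nnegrE ?mulr_ge0 ?exprn_ge0//.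
  - exact: ltW.
  - by rewrite ltW// addr_gt0.
  - by rewrite powRM ?exprn_ge0// powR_exprn// exprM.
move: kP; rewrite ltNge => /negP; apply; apply: (le_trans h1).
rewrite /theta exprMn -exprM /c.
have -> : forall P S X : R, Ca * C * P * (S * X) = Ca * S * (C * (P * X)) by move=> *; ring.
rewrite ler_wpM2l ?mulr_ge0 ?exprn_ge0 ?powR_ge0 ?(ltW Ca0)//.
by apply: (le_trans h2); rewrite ler_wpM2l ?(ltW C0).
Qed.

End Dimension.

(** * Self-affine sets satisfying the open set condition *)

Lemma coded_weaken (R : realType) (V : normedModType R) (E : set V) B u v u' v' :
  0 <= u <= u' -> 0 <= v' <= v -> coded E B u v -> coded E B u' v'.
Proof.
move=> /andP[u0 uu'] /andP[v0 vv'] [code [C [c [[C0 c0] codeB codeS close far]]]].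
exists code, C, c; split=> // x y k Ex Ey agree.
  apply: le_trans (close _ _ _ Ex Ey agree) _; rewrite ler_wpM2l ?(ltW C0)//.
  by rewrite lerXn2r// nnegrE (le_trans u0).
move=> nxy; apply: le_trans (far _ _ _ Ex Ey agree nxy); rewrite ler_wpM2l ?(ltW c0)//.
by rewrite lerXn2r// nnegrE (le_trans v0).
Qed.

Section Attractor.
Variables (R : realType) (n : nat) (A : 'M[int]_n.+1) (D : {fset 'cV[int]_n.+1}).
Variable K : set 'cV[R]_n.+1.

Local Notation M := (map_mx (intmul 1) A : 'M[R]_n.+1).
Local Notation toR := (map_mx (intmul 1) : 'cV[int]_n.+1 -> 'cV[R]_n.+1).
Local Notation dig := (fun e : D => \val e).

Lemma ifs_mapE e (y : 'cV[R]_n.+1) : M \in unitmx -> ifs_map A e (M *m y - toR e) = y.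
Proof. by move=> Mu; rewrite /ifs_map subrK mulKmx. Qed.

Lemma self_affine_digit : M \in unitmx -> self_affine_set A D K ->
  forall y, K y <-> exists e : D, K (M *m y - toR (dig e)).
Proof.
move=> Mu [_ _ KE] y; split.
  rewrite {1}KE => -[e De [x Kx <-]]; exists [` De]%fset => /=.
  by rewrite /ifs_map mulKVmx// addrK.
move=> [e Ke]; rewrite KE; exists (\val e); first exact: valP.
by exists (M *m y - toR (\val e)) => //; exact: ifs_mapE.
Qed.

Lemma open_set_condition_word_inj : M \in unitmx -> open_set_condition D (@ifs_map R n.+1 A) ->
  forall I J, size I = size J -> word_val A dig I = word_val A dig J -> I = J.
Proof.
move=> Mu [U [_ U0 _ Usub Udis]]; apply: (@osc_word_val_inj R n A D dig U) => //.
- move=> e y Ue; apply: Usub; exists (\val e); first exact: valP.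
  by exists (M *m y - toR (\val e)) => //; exact: ifs_mapE.
- move=> e f y Ue Uf; apply: contrapT => ef.
  have := Udis _ _ (valP e) (valP f); rewrite (inj_eq val_inj) => /(_ (introN eqP ef)) ef0.
  suff : (ifs_map A (\val e) @` U `&` ifs_map A (\val f) @` U) y by rewrite ef0.
  by split; [exists (M *m y - toR (\val e))|exists (M *m y - toR (\val f))] => //; exact: ifs_mapE.
Qed.

Lemma self_affine_single r : M \in unitmx -> 1 < r ->
  power_growth (invmx M) r^-1 ->
  self_affine_set A D K -> #|` D| = 1%N -> forall x y, K x -> K y -> x = y.
Proof.
move=> Mu r1 shrink hK D1 x y Kx Ky.
have [_ cK _] := hK; have Kdig := self_affine_digit Mu hK.
have [b b0 Kb] := K_bounded cK.
have ri1 : r^-1 < 1 by rewrite invf_lt1// (lt_trans ltr01).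
have ri0 : 0 < r^-1 by rewrite invr_gt0 (lt_trans ltr01).
pose al := (r^-1 + 1) / 2.
have [C C0 HC] := shrink al ltac:(by rewrite /al; lra).
apply/eqP; rewrite -subr_eq0 -normr_le0; apply/ler_addgt0Pr => e e0; rewrite add0r.
have [|k /andP[_ kP]] := @geometric_small R (e^-1 * (C * (b + b))) al; first by rewrite /al; lra.
have [I Ix] := piece_exists Kdig k Kx; have [J Jy] := piece_exists Kdig k Ky.
have IJ : I = J.
  have /card_le1_eqP : (#|{: k.-tuple D}| <= 1)%N by rewrite card_tuple -cardfE D1 exp1n.
  by apply.
rewrite -IJ in Jy.
have := same_piece_close Mu (ltW C0) (_ : 0 <= al) HC Kb Ix Jy; rewrite size_tuple => /(_ _)/le_trans; apply.
  by rewrite /al; lra.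
rewrite mulrAC; move: kP; rewrite -!mulrA mulrC ltr_pdivrMr// mul1r => /ltW.
by rewrite !mulrA.
Qed.

End Attractor.

Theorem corollary4p7 (R : realType) (d : nat) (hd : (0 < d)%N)
    (A : 'M[int]_d) (D1 D2 : {fset 'cV[int]_d}) (K K' : set 'cV[R]_d)
    (hexp : expanding R A) (hmod : equal_moduli R A)
    (hD1 : D1 != fset0) (hD2 : D2 != fset0)
    (hK : self_affine_set A D1 K) (hK' : self_affine_set A D2 K')
    (hosc1 : open_set_condition D1 (@ifs_map R d A))
    (hosc2 : open_set_condition D2 (@ifs_map R d A))
    (htd : totally_disconnected K) (htd' : totally_disconnected K') :
  nearly_lipschitz_equiv K K' <-> #|` D1| = #|` D2|.
Proof.
case: d hd A D1 D2 K K' hexp hmod hD1 hD2 hK hK' hosc1 hosc2 htd htd' => // n _.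
move=> A D1 D2 K K' hexp hmod hD1 hD2 hK hK' hosc1 hosc2 htd htd'.
have Mu := expanding_unit hexp.
have [r [r1 growth shrink]] := equal_moduli_growth hexp hmod.
have r0 : 0 < r := lt_trans ltr01 r1.
have inj1 := open_set_condition_word_inj Mu hosc1.
have inj2 := open_set_condition_word_inj Mu hosc2.
have Kdig := self_affine_digit Mu hK; have K'dig := self_affine_digit Mu hK'.
have [K0 cK _] := hK; have [K'0 cK' _] := hK'.
split=> [equiv|D12].
  have d0 : 0 < n.+1%:R :> R by [].
  apply/eqP; rewrite eqn_leq !cardfE; apply/andP; split.
    apply: (@holder_card_le R n A _ _ _ _ K' K r) => // eta eta01.
    have [sigma [C [[sigmaKK' _ _] C0 bd]]] := equiv _ eta01.
    have /andP[eta0 _] := eta01; have eta_ne : eta != 0 by rewrite gt_eqF.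
    exists sigma, ((C * n.+1%:R) `^ eta); split=> //; first by rewrite powR_gt0 ?mulr_gt0.
    move=> x y Kx Ky; have /andP[low _] := bd x y Kx Ky.
    rewrite mulrC ler_pdivrMr// in low.
    apply: le_trans (norm_le_euclidean _) _.
    rewrite -[leLHS](powRr1 (sqrtr_ge0 _)) -[X in _ `^ X](mulfV eta_ne) mulrC powRrM -div1r.
    rewrite -powRM ?mulr_ge0 ?(ltW C0)//; apply: ge0_ler_powR.
    - exact: ltW.
    - by rewrite nnegrE powR_ge0.
    - by rewrite nnegrE !mulr_ge0 ?(ltW C0).
    - apply: (le_trans low); rewrite mulrC -mulrA ler_wpM2l ?(ltW C0)//.
      exact: euclidean_le_norm.
  apply: (@holder_card_le R n A _ _ _ _ K K' r) => // eta eta01.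
  have [sigma [C [[_ _ sigmasurj] C0 bd]]] := equiv _ eta01.
  have /andP[eta0 _] := eta01.
  have /choice[tau tauP] : forall y, exists x, K' y -> K x /\ sigma x = y.
    move=> y; have [/sigmasurj[x Kx xy]|nK'y] := pselect (K' y); first by exists x.
    by exists 0.
  exists tau, (C * n.+1%:R `^ eta); split; first by rewrite mulr_gt0 ?powR_gt0.
    by move=> y /tauP[].
  move=> y z K'y K'z; have [Ky yE] := tauP y K'y; have [Kz zE] := tauP z K'z.
  have /andP[_] := bd _ _ Ky Kz; rewrite yE zE => up.
  apply: le_trans (norm_le_euclidean _) _; apply: (le_trans up).
  rewrite -mulrA -powRM// ler_wpM2l ?(ltW C0)//; apply: ge0_ler_powR; rewrite ?nnegrE ?sqrtr_ge0 ?mulr_ge0 ?(ltW eta0)//.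
  exact: euclidean_le_norm.
move=> eta /andP[eta0 eta1].
(* A one-letter alphabet codes nothing: then both sets are points. *)
have [N1|N2] : (#|` D1| = 1)%N \/ (1 < #|` D1|)%N.
  have : (0 < #|` D1|)%N by rewrite cardfs_gt0.
  lia.
  have sgl := self_affine_single Mu r1 shrink hK N1.
  have sgl' := self_affine_single Mu r1 shrink hK' (etrans (esym D12) N1).
  have [x' K'x'] := K'0; have [x Kx] := K0.
  exists (fun=> x'), 1; split=> //.
    split=> //.
    - by move=> y z /set_mem Ky /set_mem Kz _; exact: sgl.
    - by move=> y K'y; exists x => //; exact: sgl'.
  move=> y z Ky Kz; rewrite (sgl y z)// !subrr euclidean_norm0 !powR0 ?mulr0 ?lexx//.
    by rewrite gt_eqF.
  by rewrite gt_eqF// divr_gt0.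
(* With this delta, t <= delta L implies
   (1 + delta) eta (L + t) <= (1 - delta) (L - t), which compares the rates. *)
pose delta := (1 - eta) / 4.
have delta0 : 0 < delta by rewrite /delta; lra.
have delta1 : delta < 4^-1 by rewrite /delta; lra.
pose rho := r `^ (1 + delta); pose al := r `^ (- (1 - delta)).
have rrho : r < rho by rewrite -[ltLHS](powRr1 (ltW r0)) ltr_powR// ltrDl.
have ral : r^-1 < al by rewrite -(powR_inv1 (ltW r0)) ltr_powR//; lra.
have [Ca Ca0 HCa] := growth _ rrho.
have [Cb Cb0 HCb] := shrink _ ral.
have rho1 : 1 < rho := lt_trans r1 rrho.
have al0 : 0 < al by rewrite powR_gt0.
have al1 : al < 1 by rewrite -[ltRHS](powRr0 r) ltr_powR//; lra.
have al01 : 0 < al < 1 by rewrite al0.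
have N1' : (1 < #|{: D1}|)%N by rewrite -cardfE.
have N2' : (1 < #|{: D2}|)%N by rewrite -cardfE -D12.
have [t1 code1] := self_affine_coded Mu Kdig K0 cK htd inj1 rho1 al01 Ca0 Cb0 HCa HCb N1'.
have [t2 code2] := self_affine_coded Mu K'dig K'0 cK' htd' inj2 rho1 al01 Ca0 Cb0 HCa HCb N2'.
pose t := maxn t1 t2.
pose L := (t + (Num.truncn (t%:R / delta)).+1)%N.
have Lt : t%:R <= delta * L%:R.
  rewrite mulrC -ler_pdivrMr// ltW// (lt_le_trans (truncnS_gt _))// ler_nat.
  by rewrite leq_addl.
have tL : (t < L)%N by rewrite -addn1 leq_add.
pose u := al ^+ (L - t); pose v := rho^-1 ^+ (L + t).
have rhoV : 0 < rho^-1 <= 1 by rewrite invr_gt0 (lt_trans ltr01 rho1) invf_le1 ?(lt_trans ltr01 rho1)// ltW.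
have weaken (E : set 'cV[R]_n.+1) B s : (s <= t)%N ->
    coded E B (al ^+ (L - s)) (rho^-1 ^+ (L + s)) -> coded E B u v.
  have /andP[rV0 rV1] := rhoV.
  move=> st; apply: coded_weaken.
    by rewrite exprn_ge0 ?(ltW al0)//= ler_wiXn2l ?(ltW al0) ?(ltW al1)// leq_sub2l.
  by rewrite exprn_ge0 ?(ltW rV0)//= ler_wiXn2l ?(ltW rV0)// leq_add2l.
have cd1 := weaken _ _ _ (leq_maxl t1 t2) (code1 L (leq_trans (leq_maxl t1 t2) (ltnW tL))).
have cd2 := weaken _ _ _ (leq_maxr t1 t2) (code2 L (leq_trans (leq_maxr t1 t2) (ltnW tL))).
rewrite -cardfE -D12 cardfE in cd2.
have /andP[rV0 rV1] := rhoV.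
apply: (coded_nearly_lipschitz _ _ _ _ _ cd1 cd2) => //.
- by rewrite eta0.
- by rewrite exprn_gt0//= exprn_ilt1 ?(ltW al0) ?subn_eq0 -?ltnNge.
- exact: exprn_gt0.
rewrite /u /v powR_exprn ?(ltW rV0)// -!powR_mulrn ?powR_ge0 ?(ltW al0)//.
rewrite /rho -powRN /al -!powRrM ler_powR ?(ltW r1)//.
rewrite natrD natrB ?(ltnW tL)//.
have etaE : eta = 1 - 4 * delta by rewrite /delta; lra.
have d_ge0 := ltW delta0.
have dL : 0 <= delta * (delta * L%:R) := mulr_ge0 d_ge0 (mulr_ge0 d_ge0 (ler0n R L)).
have dt : 0 <= delta * t%:R := mulr_ge0 d_ge0 (ler0n R t).
have ddt : 0 <= delta * (delta * t%:R) := mulr_ge0 d_ge0 dt.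
rewrite etaE -subr_ge0.
have -> : - (1 + delta) * ((1 - 4 * delta) * (L%:R + t%:R)) - - (1 - delta) * (L%:R - t%:R) =
    2 * (delta * L%:R - t%:R) + 4 * (delta * (delta * L%:R)) + 4 * (delta * t%:R)
     + 4 * (delta * (delta * t%:R)) by ring.
lra.
Qed.
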